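(* Let $n\ge m\ge 0$ be integers. The equatorial coupling $\gamma_{m,n}\in\mathcal{M}(\mu_m,\mu_n)$ is an optimal coupling for $d_{\mathrm{GW}4,2}(\mathbb{S}^m_E,\mathbb{S}^n_E)$, i.e. it attains the infimum defining this distance. In particular, $$ d_{\mathrm{GW}4,2}(\mathbb{S}^m_E,\mathbb{S}^n_E) =\frac12\,\mathrm{dis}_{4,2}(\gamma_{m,n}) =\frac{1}{\sqrt2}\left[\frac{1}{m+1}+\frac{1}{n+1}-\frac{2}{m+1}\left(\frac{\Gamma\left(\frac{m+2}{2}\right)\Gamma\left(\frac{n+1}{2}\right)}{\Gamma\left(\frac{m+1}{2}\right)\Gamma\left(\frac{n+2}{2}\right)}\right)^2\right]^{1/4}. $$
   Context: For an integer $k\ge 0$, $\mathbb{S}^k_E$ is the unit sphere $\mathbb{S}^k\subset\mathbb{R}^{k+1}$ equipped with the Euclidean distance $\|x-x'\|$ and the uniform probability measure $\mu_k$ (for $k=0$: the two points $\pm1$, at distance $2$, each of mass $1/2$). $\mathcal{M}(\mu_m,\mu_n)$ is the set of couplings, i.e. Borel probability measures on $\mathbb{S}^m\times\mathbb{S}^n$ with marginals $\mu_m$ and $\mu_n$. For $\gamma\in\mathcal{M}(\mu_m,\mu_n)$, the $(4,2)$-distortion is $$\mathrm{dis}_{4,2}(\gamma):=\left(\int_{\mathbb{S}^m\times\mathbb{S}^n}\int_{\mathbb{S}^m\times\mathbb{S}^n}\big|\,\|x-x'\|^2-\|y-y'\|^2\,\big|^{2}\,\gamma(dx\times dy)\,\gamma(dx'\times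 dy')\right)^{1/4},$$ and $d_{\mathrm{GW}4,2}(\mathbb{S}^m_E,\mathbb{S}^n_E):=\frac12\inf_{\gamma\in\mathcal{M}(\mu_m,\mu_n)}\mathrm{dis}_{4,2}(\gamma)$. The equatorial map $e_{n,m}:\mathbb{S}^n\to\mathbb{S}^m$ is $e_{n,m}(x_1,\dots,x_{n+1}):=\frac{(x_1,\dots,x_{m+1})}{\|(x_1,\dots,x_{m+1})\|}$, defined off the $\mu_n$-null set $\{x\in\mathbb{S}^n: x_1=\dots=x_{m+1}=0\}$ and extended arbitrarily to a measurable map on all of $\mathbb{S}^n$ (for $n=m$ it is the identity). The equatorial coupling is $\gamma_{m,n}:=(e_{n,m},\mathrm{id}_{\mathbb{S}^n})_\#\mu_n$, where $\#$ denotes pushforward. $\Gamma$ is the Gamma function. *)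

(* Defs.v *)
From HB Require Import structures.
From mathcomp Require Import all_boot all_order all_algebra.
From mathcomp Require Import all_classical all_reals all_analysis.
From mathcomp Require Import measurable_realfun.

Set Implicit Arguments.
Unset Strict Implicit.
Unset Printing Implicit Defensive.

Import Order.TTheory GRing.Theory Num.Theory.
Import numFieldNormedType.Exports.

Local Open Scope classical_set_scope.
Local Open Scope ring_scope.

Section euclidean.
Context {R : realType}.

(* R^k is [k.-tuple R], whose library sigma-algebra is the product one, i.e.
   the Borel sigma-algebra of R^k. *)
Definition enorm k (x : k.-tuple R) : R :=
  Num.sqrt (\sum_(i < k) tnth x i ^+ 2).

Definition edist k (x y : k.-tuple R) : R :=
  enorm [tuple tnth x i - tnth y i | i < k].

Definition normalize k (x : k.-tuple R) : k.-tuple R :=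
  [tuple tnth x i / enorm x | i < k].

(* The default 0 of [nth] is irrelevant when m <= n. *)
Definition first_coords m n (x : n.-tuple R) : m.-tuple R :=
  [tuple nth 0 x i | i < m].

Lemma measurable_enorm k : measurable_fun [set: k.-tuple R] (@enorm k).
Proof.
apply: (measurableT_comp (f := @Num.sqrt R)).
  by apply: continuous_measurable_fun; exact: sqrt_continuous.
apply: measurable_sum => i.
by apply: measurable_funX; exact: measurable_tnth.
Qed.

Lemma measurable_normalize k : measurable_fun [set: k.-tuple R] (@normalize k).
Proof.
apply/measurable_fun_tnthP => i.
rewrite (_ : _ \o _ = fun x => tnth x i * (enorm x) `^ (-1)); last first.
  by apply/funext => x /=; rewrite tnth_mktuple powR_inv1// sqrtr_ge0.
apply: measurable_funM; first exact: measurable_tnth.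
apply: (measurableT_comp (f := @powR R ^~ (-1))); last exact: measurable_enorm.
exact: measurable_powR.
Qed.

Definition cons_pair k (p : measurableTypeR R * k.-tuple R) : k.+1.-tuple R :=
  [tuple of (p.1 : R) :: p.2].

Lemma measurable_cons_pair k : measurable_fun setT (@cons_pair k).
Proof.
apply: (measurable_cons (f := fst : _ -> R)); last exact: measurable_snd.
exact: (@measurable_fst _ _ (measurableTypeR R)).
Qed.

HB.instance Definition _ k :=
  isMeasurableFun.Build _ _ _ _ (@cons_pair k) (@measurable_cons_pair k).

Section lebesgue_cons.
Variables (k : nat) (mu : {sigma_finite_measure set (k.-tuple R) -> \bar R}).

Definition lebesgue_cons : set (k.+1.-tuple R) -> \bar R :=
  pushforward (lebesgue_measure \x mu)%E (@cons_pair k).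

Let lebesgue_cons0 : lebesgue_cons set0 = 0%E.
Proof. exact: measure0. Qed.

Let lebesgue_cons_ge0 A : (0 <= lebesgue_cons A)%E.
Proof. exact: measure_ge0. Qed.

Let lebesgue_cons_sigma_additive : semi_sigma_additive lebesgue_cons.
Proof. exact: measure_semi_sigma_additive. Qed.

HB.instance Definition _ := isMeasure.Build _ _ _ lebesgue_cons
  lebesgue_cons0 lebesgue_cons_ge0 lebesgue_cons_sigma_additive.

Let sigma_finite_lebesgue_cons : sigma_finite setT lebesgue_cons.
Proof.
have /sigma_finiteP[F [TF ndF Foo]] := sigma_finiteT (@lebesgue_measure R).
have /sigma_finiteP[G [TG ndG Goo]] := sigma_finiteT mu.
pose g (x : k.+1.-tuple R) : measurableTypeR R * k.-tuple R :=
  (thead x, [tuple of behead x]).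
have mg : measurable_fun setT g.
  apply/measurable_fun_pairP; split; last exact: measurable_behead.
  exact: (@measurable_tnth _ R).
have gK p : g (cons_pair p) = p.
  by case: p => a t; congr pair; exact/val_inj.
exists (fun i => g @^-1` (F i `*` G i)).
  apply/seteqP; split => // x _.
  have [i _ Fi] : (\bigcup_i F i) (g x).1 by rewrite -TF.
  have [j _ Gj] : (\bigcup_i G i) (g x).2 by rewrite -TG.
  exists (maxn i j) => //; split.
  - by move: Fi; exact/subsetPset/ndF/leq_maxl.
  - by move: Gj; exact/subsetPset/ndG/leq_maxr.
move=> i; have [mFi Fi] := Foo i; have [mGi Gi] := Goo i; split.
  by rewrite -[X in measurable X]setTI; apply: mg => //; exact: measurableX.
rewrite /lebesgue_cons/= /pushforward -comp_preimage (_ : _ \o _ = id).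
  by rewrite preimage_id product_measure1E// lte_mul_pinfty// ge0_fin_numE.
by apply/funext => p; exact: gK.
Qed.

HB.instance Definition _ :=
  Measure_isSigmaFinite.Build _ _ _ lebesgue_cons sigma_finite_lebesgue_cons.

End lebesgue_cons.

Fixpoint lebesgue_tuple k : {sigma_finite_measure set (k.-tuple R) -> \bar R} :=
  match k with
  | 0 => dirac [tuple]
  | k.+1 => lebesgue_cons (lebesgue_tuple k)
  end.

Definition unit_ball k : set (k.-tuple R) := [set x | enorm x <= 1].
Arguments unit_ball : clear implicits.

Lemma measurable_unit_ball k : measurable (unit_ball k).
Proof.
rewrite (_ : unit_ball k = setT `&` @enorm k @^-1` `]-oo, 1]); last first.
  by apply/seteqP; split => x /=; rewrite in_itv/= => //; case.
by apply: measurable_enorm => //; exact: measurable_itv.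
Qed.

End euclidean.

Section sphere.
Context (R : realType) (k : nat).

Record sphere := Sphere {
  sphere_val :> k.+1.-tuple R;
  sphereP : enorm sphere_val == 1 }.

HB.instance Definition _ := [isSub for sphere_val].
HB.instance Definition _ := [Choice of sphere by <:].

Let north : k.+1.-tuple R := [tuple (i == ord0)%:R | i < k.+1].

Let northP : enorm north == 1.
Proof.
rewrite /enorm big_ord_recl big1 => [|i _]; last first.
  by rewrite tnth_mktuple expr0n.
by rewrite tnth_mktuple expr1n addr0 sqrtr1.
Qed.

HB.instance Definition _ := isPointed.Build sphere (Sphere northP).

(* The trace on the sphere of the Borel sigma-algebra of R^(k+1). *)
HB.instance Definition _ :=
  Measurable.copy sphere (g_sigma_algebra_preimageType sphere_val).

Lemma measurable_sphereP d (T : measurableType d) (f : T -> sphere) :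
  measurable_fun setT (sphere_val \o f) -> measurable_fun setT f.
Proof.
move=> mf _ Y [B mB <-]; rewrite !setTI -comp_preimage -[X in measurable X]setTI.
exact: mf.
Qed.

(* x |-> x / |x|, with a junk value at x = 0. *)
Definition radial (x : k.+1.-tuple R) : sphere :=
  insubd (point : sphere) (normalize x).

Lemma measurable_radial : measurable_fun setT radial.
Proof.
apply: measurable_sphereP.
rewrite (_ : _ \o _ = fun x => if enorm (normalize x) == 1 then normalize x
                               else sphere_val (point : sphere)); last first.
  by apply/funext => x /=; rewrite val_insubd.
apply: measurable_fun_ifT => //; last exact: measurable_normalize.
apply: (measurable_fun_eqr (g := fun=> 1)); last exact: measurable_cst.
apply: measurableT_comp; [exact: measurable_enorm|exact: measurable_normalize].
Qed.

HB.instance Definition _ :=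
  isMeasurableFun.Build _ _ _ _ radial measurable_radial.

(* Uniform measure: the normalized surface measure, A |-> the proportion of the
   volume of the unit ball lying in the cone over A. The ball has positive
   finite volume, so the second argument of [mnormalize] is a junk value. *)
Definition sphere_unif : probability sphere R :=
  distribution
    (mnormalize (mrestr (@lebesgue_tuple R k.+1) (@measurable_unit_ball R k.+1))
                (dirac point))
    radial.

End sphere.

Section gromov_wasserstein.
Context d1 d2 (X : measurableType d1) (Y : measurableType d2) (R : realType).

Definition coupling (muX : probability X R) (muY : probability Y R) :
    set (probability (X * Y)%type R) :=
  [set g | (forall A, measurable A -> g (A `*` setT) = muX A) /\
           (forall B, measurable B -> g (setT `*` B) = muY B)].

Variables (dX : X -> X -> R) (dY : Y -> Y -> R).

Definition dis42 (g : probability (X * Y)%type R) : \bar R :=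
  ((\int[g]_p \int[g]_q
     (`| dX p.1 q.1 ^+ 2 - dY p.2 q.2 ^+ 2 | ^+ 2)%:E) `^ (4^-1))%E.

Definition dGW42 (muX : probability X R) (muY : probability Y R) : \bar R :=
  ((2^-1)%:E * ereal_inf [set dis42 g | g in coupling muX muY])%E.

Definition optimal42 (muX : probability X R) (muY : probability Y R)
    (g : probability (X * Y)%type R) :=
  coupling muX muY g /\
  dis42 g = ereal_inf [set dis42 g' | g' in coupling muX muY].

End gromov_wasserstein.

Section equatorial.
Context {R : realType} {m n : nat}.

Definition sphere_dist k (x y : sphere R k) : R := edist x y.

(* For m <= n: a measurable map S^n -> S^m given by the equatorial formula
   wherever that formula makes sense, and arbitrary elsewhere. *)
Definition equatorial_map (e : {mfun sphere R n >-> sphere R m}) :=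
  forall x : sphere R n, enorm (first_coords m.+1 x) != 0 ->
    sphere_val (e x) = normalize (first_coords m.+1 x).

Definition graph_map (e : {mfun sphere R n >-> sphere R m}) (x : sphere R n) :
  (sphere R m * sphere R n)%type := (e x, x).

Lemma measurable_graph_map (e : {mfun sphere R n >-> sphere R m}) :
  measurable_fun setT (graph_map e).
Proof. by apply: measurable_fun_pair => //; exact: measurable_id. Qed.

HB.instance Definition _ (e : {mfun sphere R n >-> sphere R m}) :=
  isMeasurableFun.Build _ _ _ _ (graph_map e) (measurable_graph_map e).

Definition equatorial_coupling (e : {mfun sphere R n >-> sphere R m}) :
    probability (sphere R m * sphere R n)%type R :=
  distribution (sphere_unif R n) (graph_map e).

End equatorial.

(* Only meaningful for s > 0. *)
Definition Gamma (R : realType) (s : R) : R :=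
  \int[lebesgue_measure]_(t in `]0, +oo[) (t `^ (s - 1) * expR (- t)).

(* Main.v *)
Require Import Defs.
From HB Require Import structures.
From mathcomp Require Import all_boot all_order all_algebra fingroup perm.
From mathcomp Require Import all_classical all_reals all_analysis.
From mathcomp Require Import measurable_realfun ring lra.

Set Implicit Arguments.
Unset Strict Implicit.
Unset Printing Implicit Defensive.

Import Order.TTheory GRing.Theory Num.Theory.
Import numFieldNormedType.Exports.

Local Open Scope classical_set_scope.
Local Open Scope ring_scope.

(** Since points of a sphere satisfy |x - x'|^2 = 2 - 2 <x, x'>, the integrand
of the distortion is 4 (<x, x'> - <y, y'>)^2.  Expanding the square, the two
pure terms only see the marginals, whose second moments are 1/(m+1) and 1/(n+1)
times the identity, and the mixed term is the squared Frobenius norm of the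
correlation matrix M = E[x y^T] of the coupling:
  dis^4 = 4 (1/(m+1) + 1/(n+1) - 2 |M|^2)      (distortionE).
Hence the problem is to maximize |M|.

Write y_A for the first m+1 coordinates of y and C for the mean of |y_A| over
the n-sphere.  The claim is |M|^2 <= C^2/(m+1) (sqr_frob_corr_le).  Householder
reflections give an orthogonal P with M P = (B 0), B square
(lower_trapezoidal).  With q = P^T y and u = q_A / |q_A|,
  |M|^2 = E <x, M y> = E |q_A| <x, B u>
       <= E |q_A| (s + |B u|^2 / s) / 2        for every s > 0.
The uniform measure is invariant under P, so q may be replaced by a uniform y,
and by sign flips and coordinate swaps E[|y_A| u_k u_l] is C/(m+1) if k = l
and 0 otherwise.  The bound becomes (s C + |M|^2 C / ((m+1) s)) / 2, and
s = |M| / sqrt (m+1) gives |M|^2 <= C |M| / sqrt (m+1).  For the equatorial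
coupling x = u, so the same moments say that M is C/(m+1) times (1 0), which
attains the bound (sqr_frob_corr_equatorial).

The analytic input is about Lebesgue measure on R^k and its Gaussian weight.
- Orthogonal invariance (ge0_integral_mxact) comes from the uniqueness argument
  for Haar measure: for b the indicator of the unit ball, exchanging the
  integrations in the double integral of b(x) f(P y + x) evaluates the volume
  of the ball times the integral of f o P in two ways.
- polar_decomposition: integrating t^(p/2-1) e^(-t) f(x) over |x|^2 <= t, for f
  homogeneous of degree 0, first in x and then in t, or conversely, compares
  the Gaussian integral of f |x|^p with Gamma((k+p)/2) times the mean of f over
  the sphere, up to a constant that depends neither on f nor on p.
- The Gaussian weight factors over the first m+1 and the last n-m coordinates.
  Together with the previous point, this shows that the equatorial map sends
  the uniform measure to the uniform measure, that y_A vanishes almost nowhere,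
  and that C is the stated quotient of Gamma values. *)

(** * Affine substitutions on the line *)

Section line.
Context {R : realType}.
Local Notation leb := (@lebesgue_measure R).
Local Open Scope ereal_scope.

(** Both sides agree on half-open intervals, which determine the measure. *)
Lemma lebesgue_measure_affine (a b : R) (A : set (measurableTypeR R)) :
  (0 < a)%R -> measurable A ->
  a%:E * pushforward leb ((fun t => a * t + b)%R : _ -> measurableTypeR R) A
  = leb A.
Proof.
move=> a0 mA.
have mf : measurable_fun [set: measurableTypeR R]
    ((fun t => a * t + b)%R : _ -> measurableTypeR R).
  by apply: measurable_funD => //; exact: measurable_funM.
pose f_mixin := isMeasurableFun.Build _ _ _ _ _ mf.
pose f : {mfun measurableTypeR R >-> measurableTypeR R} :=
  HB.pack ((fun t => a * t + b)%R : measurableTypeR R -> measurableTypeR R)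
    f_mixin.
apply/esym/(@lebesgue_measure_unique _
  (mscale (NngNum (ltW a0)) (pushforward leb f))) => //.
move=> _ [[c d]] /= _ <-; rewrite /mscale /= /pushforward /=.
rewrite (_ : _ @^-1` _ = `](c - b) / a, (d - b) / a]%classic)%R; last first.
  apply/seteqP; split => x /=;
    rewrite !in_itv /= ltr_pdivrMr // ler_pdivlMr // ltrBlDr lerBrDr;
    by rewrite (mulrC a).
rewrite !lebesgue_measure_itv /= !lte_fin.
rewrite ltr_pM2r ?invr_gt0// ltrD2r; case: ifP => _; last by rewrite mule0.
by rewrite -!EFinB -EFinM; congr EFin; field; rewrite gt_eqF.
Qed.

Lemma ge0_integral_affine (a b : R) (f : R -> \bar R) :
  (0 < a)%R -> measurable_fun setT f -> (forall x, 0 <= f x) ->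
  a%:E * \int[leb]_x f (a * x + b)%R = \int[leb]_x f x.
Proof.
move=> a0 mf f0.
have mg : measurable_fun [set: measurableTypeR R]
    ((fun t => a * t + b)%R : _ -> measurableTypeR R).
  by apply: measurable_funD => //; exact: measurable_funM.
pose g_mixin := isMeasurableFun.Build _ _ _ _ _ mg.
pose g : {mfun measurableTypeR R >-> measurableTypeR R} :=
  HB.pack ((fun t => a * t + b)%R : measurableTypeR R -> measurableTypeR R)
    g_mixin.
rewrite [RHS](eq_measure_integral
  (mscale (NngNum (ltW a0)) (pushforward leb g))); last first.
  by move=> A mA _; rewrite /= /mscale /= lebesgue_measure_affine.
rewrite ge0_integral_mscale //; congr (_ * _).
by rewrite ge0_integral_pushforward.
Qed.

Lemma ge0_integral_translate (b : R) (f : R -> \bar R) :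
  measurable_fun setT f -> (forall x, 0 <= f x) ->
  \int[leb]_x f (x + b)%R = \int[leb]_x f x.
Proof.
move=> mf f0; rewrite -(@ge0_integral_affine 1 b f)// mul1e.
by apply: eq_integral => x _; rewrite mul1r.
Qed.

End line.

(** * Lebesgue measure on tuples: translations and dilations *)

Section lebesgue_tuple_theory.
Context {R : realType}.
Local Notation leb := (@lebesgue_measure R).

Definition tadd k (x a : k.-tuple R) : k.-tuple R :=
  [tuple tnth x i + tnth a i | i < k].

Definition tscale k (r : R) (x : k.-tuple R) : k.-tuple R :=
  [tuple r * tnth x i | i < k].

Lemma measurable_tadd d (T : measurableType d) k (f g : T -> k.-tuple R) :
  measurable_fun setT f -> measurable_fun setT g ->
  measurable_fun setT (fun t => tadd (f t) (g t)).
Proof.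
move=> mf mg; apply/measurable_fun_tnthP => i.
rewrite (_ : _ \o _ = fun t => tnth (f t) i + tnth (g t) i).
  by apply: measurable_funD; exact: (measurableT_comp (measurable_tnth i)).
by apply/funext => t /=; rewrite tnth_mktuple.
Qed.

Lemma measurable_taddr k a : measurable_fun setT (@tadd k ^~ a).
Proof. exact: measurable_tadd. Qed.

Lemma measurable_tscaler k r : measurable_fun setT (@tscale k r).
Proof.
apply/measurable_fun_tnthP => i.
rewrite (_ : _ \o _ = fun x => r * tnth x i).
  by apply: measurable_funM => //; exact: measurable_tnth.
by apply/funext => x /=; rewrite tnth_mktuple.
Qed.

Lemma tadd_cons k t (x : k.-tuple R) s a :
  tadd (cons_pair (t, x)) (cons_pair (s, a)) = cons_pair (t + s, tadd x a).
Proof.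
apply: eq_from_tnth => i; rewrite tnth_mktuple.
by case: (unliftP ord0 i) => [j|] ->; rewrite ?tnthS ?tnth0 ?tnth_mktuple.
Qed.

Lemma tscale_cons k r t (x : k.-tuple R) :
  tscale r (cons_pair (t, x)) = cons_pair (r * t, tscale r x).
Proof.
apply: eq_from_tnth => i; rewrite tnth_mktuple.
by case: (unliftP ord0 i) => [j|] ->; rewrite ?tnthS ?tnth0 ?tnth_mktuple.
Qed.

Lemma cons_pair_eta k (x : k.+1.-tuple R) :
  x = cons_pair (thead x, [tuple of behead x]).
Proof. by rewrite [LHS]tuple_eta. Qed.

Local Open Scope ereal_scope.

(** The recursive definition of the measure turned into an iterated integral;
every property of the measure below is an induction through this formula. *)
Lemma ge0_integral_cons k (f : k.+1.-tuple R -> \bar R) :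
  measurable_fun setT f -> (forall x, 0 <= f x) ->
  \int[lebesgue_tuple k.+1]_x f x =
  \int[leb]_t \int[lebesgue_tuple k]_x f (cons_pair (t, x)).
Proof.
move=> mf f0.
rewrite (eq_measure_integral
  (pushforward (leb \x lebesgue_tuple k) (@cons_pair R k))) //.
rewrite (ge0_integral_pushforward (measurable_cons_pair (k := k))) //=.
rewrite (fubini_tonelli1 (f \o @cons_pair R k)) //.
  by apply: measurableT_comp => //; exact: measurable_cons_pair.
by move=> x; exact: f0.
Qed.

Lemma measurable_integral_cons k (f : k.+1.-tuple R -> \bar R) :
  measurable_fun setT f -> (forall x, 0 <= f x) ->
  measurable_fun [set: measurableTypeR R]
    (fun t => \int[lebesgue_tuple k]_x f (cons_pair (t, x))).
Proof.
move=> mf f0.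
apply: (measurable_fun_fubini_tonelli_F (f \o @cons_pair R k)) => //=.
by apply: measurableT_comp => //; exact: measurable_cons_pair.
Qed.

Lemma measurable_cons_pairr k t :
  measurable_fun setT (fun x => @cons_pair R k (t, x)).
Proof.
exact: (measurableT_comp (@measurable_cons_pair _ k)
  (@pair1_measurable _ _ (measurableTypeR R) _ t)).
Qed.

Lemma integral_tuple0 (f : 0.-tuple R -> \bar R) :
  measurable_fun setT f -> \int[lebesgue_tuple 0]_x f x = f [tuple].
Proof. by move=> mf; rewrite integral_dirac // diracT mul1e. Qed.

Lemma ge0_integral_tadd k a (f : k.-tuple R -> \bar R) :
  measurable_fun setT f -> (forall x, 0 <= f x) ->
  \int[lebesgue_tuple k]_x f (tadd x a) = \int[lebesgue_tuple k]_x f x.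
Proof.
elim: k a f => [|k IH] a f mf f0.
  by apply: eq_integral => x _; congr f; rewrite [LHS]tuple0 [RHS]tuple0.
rewrite (cons_pair_eta a); set s := thead a; set b := [tuple of behead a].
rewrite ge0_integral_cons //; last first.
  by apply: measurableT_comp => //; exact: measurable_taddr.
under eq_integral do under eq_integral do rewrite tadd_cons.
under eq_integral => t _.
  rewrite (IH b (fun x => f (cons_pair ((t + s)%R, x)))) //; last first.
    by apply: measurableT_comp => //; exact: measurable_cons_pairr.
  over.
rewrite /= (@ge0_integral_translate _ s
  (fun t => \int[lebesgue_tuple k]_x f (cons_pair (t, x)))).
- by rewrite -ge0_integral_cons.
- exact: measurable_integral_cons.
- by move=> t; exact: integral_ge0.
Qed.

Lemma ge0_integral_tscale k r (f : k.-tuple R -> \bar R) : (0 < r)%R ->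
  measurable_fun setT f -> (forall x, 0 <= f x) ->
  (r ^+ k)%:E * \int[lebesgue_tuple k]_x f (tscale r x)
  = \int[lebesgue_tuple k]_x f x.
Proof.
move=> r0; elim: k f => [|k IH] f mf f0.
  rewrite expr0 mul1e.
  by apply: eq_integral => x _; congr f; rewrite [LHS]tuple0 [RHS]tuple0.
rewrite ge0_integral_cons //; last first.
  by apply: measurableT_comp => //; exact: measurable_tscaler.
under eq_integral do under eq_integral do rewrite tscale_cons.
pose F t := \int[lebesgue_tuple k]_x f (cons_pair (t, x)).
have mF : measurable_fun [set: measurableTypeR R] F.
  exact: measurable_integral_cons.
have F0 t : 0 <= F t by exact: integral_ge0.
have rk0 : (0 < r ^+ k)%R by rewrite exprn_gt0.
rewrite exprS EFinM -muleA -ge0_integralZl_EFin ?(ltW rk0)//; last 2 first.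
  by move=> t _; exact: integral_ge0.
  have := @measurable_integral_cons k (fun x => f (tscale r x)).
  under [X in _ -> _ -> measurable_fun _ X]eq_fun
    do under eq_integral do rewrite tscale_cons.
  apply => //.
  by apply: measurableT_comp => //; exact: measurable_tscaler.
under eq_integral => t _.
  rewrite (IH (fun x => f (cons_pair ((r * t)%R, x)))) //; last first.
    by apply: measurableT_comp => //; exact: measurable_cons_pairr.
  over.
rewrite [X in _ * X](_ : _ = \int[leb]_t F (r * t + 0)%R); last first.
  by apply: eq_integral => t _; rewrite addr0.
by rewrite ge0_integral_affine // -ge0_integral_cons.
Qed.

End lebesgue_tuple_theory.

(** * Euclidean norm and Gaussian weight *)

Section enorm_theory.
Context {R : realType}.
Local Notation leb := (@lebesgue_measure R).

Lemma enorm_ge0 k (x : k.-tuple R) : 0 <= enorm x.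
Proof. exact: sqrtr_ge0. Qed.

Lemma sqr_enorm k (x : k.-tuple R) : enorm x ^+ 2 = \sum_(i < k) tnth x i ^+ 2.
Proof. by rewrite sqr_sqrtr // sumr_ge0 // => i _; exact: sqr_ge0. Qed.

Lemma enorm_eq0P k (x : k.-tuple R) :
  reflect (forall i, tnth x i = 0) (enorm x == 0).
Proof.
rewrite -sqrf_eq0 sqr_enorm.
rewrite psumr_eq0 => [|i _]; last exact: sqr_ge0.
apply: (iffP allP) => [x0 i|x0 i _]; last by rewrite x0 expr0n /= eqxx.
by have := x0 i (mem_index_enum i); rewrite sqrf_eq0 => /eqP.
Qed.

Lemma ler_tnth_enorm k (x : k.-tuple R) i : `|tnth x i| <= enorm x.
Proof.
rewrite -sqrtr_sqr ler_sqrt; last by apply: sumr_ge0 => j _; exact: sqr_ge0.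
by rewrite (bigD1 i)//= lerDl sumr_ge0// => j _; exact: sqr_ge0.
Qed.

Lemma sqr_enorm_cons k t (x : k.-tuple R) :
  enorm (cons_pair (t, x)) ^+ 2 = t ^+ 2 + enorm x ^+ 2.
Proof.
rewrite !sqr_enorm big_ord_recl tnth0; congr (_ + _).
by apply: eq_bigr => i _; rewrite tnthS.
Qed.

Lemma enorm_tscale k r (x : k.-tuple R) : 0 <= r ->
  enorm (tscale r x) = r * enorm x.
Proof.
move=> r0; apply/eqP.
rewrite -(@eqrXn2 _ 2%N) ?mulr_ge0 ?enorm_ge0 //; apply/eqP.
rewrite exprMn !sqr_enorm mulr_sumr; apply: eq_bigr => i _.
by rewrite tnth_mktuple exprMn.
Qed.

Lemma measurable_enorm_eq0 k : measurable [set x : k.-tuple R | enorm x = 0].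
Proof.
rewrite -[X in measurable X]setTI.
by apply: (@measurable_enorm R k measurableT [set 0]); exact: measurable_set1.
Qed.

(** The origin forces the first coordinate into a singleton of the line. *)
Lemma lebesgue_tuple_enorm_eq0 k :
  lebesgue_tuple k.+1 [set x : k.+1.-tuple R | enorm x = 0] = 0%E.
Proof.
have mA := @measurable_enorm_eq0 k.+1.
rewrite -[LHS]mul1e -integral_cst // integral_mkcond.
rewrite ge0_integral_cons; last 2 first.
- by apply: (measurable_restrictT _ _).1 => //; exact: measurable_cst.
- by move=> x; rewrite erestrict_ge0.
transitivity (\int[leb]_(t in [set 0%R]) (\int[lebesgue_tuple k]_x
   (cst 1%E \_ [set x : k.+1.-tuple R | enorm x = 0%R]) (cons_pair (t, x))))%E.
  rewrite [RHS]integral_mkcond; apply: eq_integral => t _.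
  rewrite [RHS]patchE; case: ifPn => // t0.
  apply: integral0_eq => x _; rewrite patchE ifN // notin_setE /=.
  move=> /eqP/enorm_eq0P/(_ ord0); rewrite tnth0 /= => t00; move: t0.
  by rewrite t00 notin_setE => /(_ erefl).
exact: integral_set1.
Qed.

Definition gaussian k (x : k.-tuple R) : R := expR (- enorm x ^+ 2).

Lemma gaussian_ge0 k (x : k.-tuple R) : 0 <= gaussian x.
Proof. exact: expR_ge0. Qed.

Lemma measurable_gaussian k : measurable_fun setT (@gaussian k).
Proof.
apply: measurableT_comp => //; apply: measurableT_comp => //.
by apply: measurable_funX; exact: measurable_enorm.
Qed.

Lemma emeasurable_gaussian k :
  measurable_fun setT (fun x : k.-tuple R => (gaussian x)%:E).
Proof. by apply/measurable_EFinP; exact: measurable_gaussian. Qed.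

Lemma gaussian_cons k t (x : k.-tuple R) :
  gaussian (cons_pair (t, x)) = expR (- t ^+ 2) * gaussian x.
Proof. by rewrite /gaussian sqr_enorm_cons opprD expRD. Qed.

Lemma measurable_first_coords m n : measurable_fun setT (@first_coords R m n).
Proof.
apply/measurable_fun_tnthP => i.
have [lt|ge] := ltnP i n.
  rewrite (_ : _ \o _ = fun x : n.-tuple R => tnth x (Ordinal lt)).
    exact: measurable_tnth.
  by apply/funext => x /=; rewrite tnth_mktuple (tnth_nth 0).
rewrite (_ : _ \o _ = cst 0); first exact: measurable_cst.
by apply/funext => x /=; rewrite tnth_mktuple nth_default // size_tuple.
Qed.

Lemma first_coords_cons m n t (x : n.-tuple R) :
  first_coords m.+1 (cons_pair (t, x)) = cons_pair (t, first_coords m x).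
Proof.
apply: eq_from_tnth => i; rewrite tnth_mktuple.
by case: (unliftP ord0 i) => [j|] ->; rewrite ?tnthS ?tnth0 ?tnth_mktuple.
Qed.

Local Open Scope ereal_scope.

(** The Gaussian weight is a product over coordinates, so integrating out the
last ones only contributes a factor. *)
Lemma ge0_integral_gaussian_first a b (G : a.-tuple R -> \bar R) :
  measurable_fun setT G -> (forall x, 0 <= G x) ->
  \int[lebesgue_tuple (a + b)]_x (G (first_coords a x) * (gaussian x)%:E) =
  \int[lebesgue_tuple a]_x (G x * (gaussian x)%:E) *
  \int[lebesgue_tuple b]_x (gaussian x)%:E.
Proof.
elim: a G => [|a IH] G mG G0.
  rewrite integral_tuple0; last first.
    by apply: emeasurable_funM => //; exact: emeasurable_gaussian.
  rewrite {2}/gaussian sqr_enorm big_ord0 oppr0 expR0 mule1.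
  under eq_integral => x _ do rewrite [first_coords _ _]tuple0.
  rewrite ge0_integralZl //.
    by apply/measurable_EFinP; exact: measurable_gaussian.
  by move=> x _; rewrite lee_fin gaussian_ge0.
have mGg : measurable_fun setT (fun x : a.+1.-tuple R => G x * (gaussian x)%:E).
  by apply: emeasurable_funM => //; exact: emeasurable_gaussian.
have Gg0 (x : a.+1.-tuple R) : 0 <= G x * (gaussian x)%:E.
  by rewrite mule_ge0 // lee_fin gaussian_ge0.
rewrite [in RHS]ge0_integral_cons // -ge0_integralZr//; last 3 first.
- exact: (measurable_integral_cons (f := fun x => G x * (gaussian x)%:E)).
- by move=> t _; exact: integral_ge0.
- by apply: integral_ge0 => x _; rewrite lee_fin gaussian_ge0.
rewrite (@ge0_integral_cons _ (a + b)); last 2 first.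
- apply: emeasurable_funM => //.
    by apply: measurableT_comp => //; exact: measurable_first_coords.
  exact: emeasurable_gaussian.
- by move=> x; rewrite mule_ge0 // lee_fin gaussian_ge0.
apply: eq_integral => t _.
have mGt : measurable_fun setT (fun x : a.-tuple R => G (cons_pair (t, x))).
  by apply: measurableT_comp => //; exact: measurable_cons_pairr.
have mGtg : measurable_fun setT
    (fun x : a.-tuple R => G (cons_pair (t, x)) * (gaussian x)%:E).
  by apply: emeasurable_funM => //; exact: emeasurable_gaussian.
have Gtg0 (x : a.-tuple R) : 0 <= G (cons_pair (t, x)) * (gaussian x)%:E.
  by rewrite mule_ge0 // lee_fin gaussian_ge0.
under eq_integral => x _.
  rewrite first_coords_cons gaussian_cons EFinM muleCA; over.
under [in RHS]eq_integral => x _.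
  rewrite gaussian_cons EFinM muleCA; over.
rewrite ge0_integralZl //=; last 2 first.
- apply: emeasurable_funM => //.
    by apply: (measurableT_comp mGt); exact: measurable_first_coords.
  by apply/measurable_EFinP; exact: measurable_gaussian.
- by move=> x _; rewrite mule_ge0 // lee_fin gaussian_ge0.
rewrite (IH (fun x => G (cons_pair (t, x)))) //.
by rewrite ge0_integralZl ?lee_fin ?expR_ge0 // muleA.
Qed.

Lemma integral_gaussian_gt0_lty k :
  0 < \int[lebesgue_tuple k]_x (gaussian x : R)%:E < +oo.
Proof.
elim: k => [|k IH].
  rewrite integral_tuple0; last first.
    by apply/measurable_EFinP; exact: measurable_gaussian.
  by rewrite lte_fin expR_gt0 ltry.
rewrite ge0_integral_cons; last 2 first.
- by apply/measurable_EFinP; exact: measurable_gaussian.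
- by move=> x; rewrite lee_fin gaussian_ge0.
under eq_integral => t _.
  under eq_integral => x _ do rewrite gaussian_cons EFinM.
  rewrite ge0_integralZl ?lee_fin ?expR_ge0 //; last 2 first.
  - by apply/measurable_EFinP; exact: measurable_gaussian.
  - by move=> x _; rewrite lee_fin gaussian_ge0.
  over.
case/andP: IH => IH0 IHy.
have fin : \int[lebesgue_tuple k]_x (gaussian x : R)%:E \is a fin_num.
  by rewrite ge0_fin_numE // ltW.
rewrite /= ge0_integralZr //; last 2 first.
- by apply/measurable_EFinP; exact: measurable_gauss_fun.
- exact: ltW.
have -> : \int[leb]_t (expR (- t ^+ 2))%:E = (Num.sqrt pi)%:E :> \bar R.
  exact: integralT_gauss.
rewrite -(fineK fin) -EFinM lte_fin ltry andbT mulr_gt0 ?sqrtr_gt0 ?pi_gt0 //.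
exact: fine_gt0 (introT andP (conj IH0 IHy)).
Qed.

End enorm_theory.

(** * Polar decomposition of Gaussian integrals *)

Section polar.
Context {R : realType}.
Local Notation leb := (@lebesgue_measure R).
Implicit Types (k : nat) (p s : R).

(** The Gamma integral as an extended real: that it is finite at positive
half-integers is a consequence of the comparison with Gaussian integrals. *)
Definition eGamma s : \bar R :=
  (\int[leb]_(t in `]0%R, +oo[) (t `^ (s - 1) * expR (- t))%:E)%E.

(** The constant left over by the radial variable in the polar decomposition;
its value is 2/k. *)
Definition radial_mass k : \bar R :=
  (\int[leb]_(u in `[1%R, +oo[) (u `^ (- (k%:R / 2) - 1))%:E)%E.

Definition homogeneous0 k (f : k.-tuple R -> R) :=
  forall r x, 0 < r -> f (tscale r x) = f x.

Lemma powRDr (a x y : R) : 0 < a -> a `^ (x + y) = a `^ x * a `^ y.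
Proof. by move=> a0; rewrite powRD // (gt_eqF a0) implybT. Qed.

Lemma sqrt_exprn (r : R) k : 0 <= r -> Num.sqrt r ^+ k = r `^ (k%:R / 2).
Proof.
move=> r0.
by rewrite -powR12_sqrt // -powR_mulrn ?powR_ge0 // -powRrM mulrC.
Qed.

Lemma sqr_powR_half (a p : R) : 0 <= a -> (a ^+ 2) `^ (p / 2) = a `^ p.
Proof.
by move=> a0; rewrite -powR_mulrn // -powRrM mulrCA divff // mulr1.
Qed.

Section polar_decomposition.
Context (k : nat) (p : R) (f : k.+1.-tuple R -> R).
Hypotheses (mf : measurable_fun setT f) (f0 : forall x, 0 <= f x).
Hypothesis hf : homogeneous0 f.

Local Notation K := k.+1.
Local Notation V := (\int[lebesgue_tuple K]_(x in @unit_ball R K) (f x)%:E)%E.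

(* Its two iterated integrals are the two sides of the decomposition. *)
Let kern (z : measurableTypeR R * K.-tuple R) : R :=
  if (0 < z.1) && (enorm z.2 ^+ 2 <= z.1) then
    z.1 `^ (p / 2 - 1) * expR (- z.1) * f z.2 else 0.

(* The kernel after the substitution t = |x|^2 u, which turns the constraint
   |x|^2 <= t into 1 <= u. *)
Let kern' (z : measurableTypeR R * K.-tuple R) : R :=
  if 1 <= z.1 then
    z.1 `^ (p / 2 - 1) *
    (enorm z.2 `^ p * expR (- (z.1 * enorm z.2 ^+ 2)) * f z.2)
  else 0.

Let mfst : measurable_fun setT
  (fun z : measurableTypeR R * K.-tuple R => z.1 : R).
Proof. exact: (@measurable_fst _ _ (measurableTypeR R) (K.-tuple R)). Qed.

Let msnd : measurable_fun setT
  (fun z : measurableTypeR R * K.-tuple R => z.2).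
Proof. exact: (@measurable_snd _ _ (measurableTypeR R) (K.-tuple R)). Qed.

Let mnorm : measurable_fun setT
  (fun z : measurableTypeR R * K.-tuple R => enorm z.2).
Proof. exact: (measurableT_comp (@measurable_enorm R K)). Qed.

Let mkern : measurable_fun setT kern.
Proof.
apply: measurable_fun_ifT => //; last first.
  apply: measurable_funM; last exact: measurableT_comp.
  apply: measurable_funM.
    exact: (measurableT_comp (measurable_powR _)).
  by apply: measurableT_comp => //; exact: measurableT_comp.
apply: measurable_and.
  exact: measurable_fun_ltr.
by apply: measurable_fun_ler => //; exact: measurable_funX.
Qed.

Let mkern' : measurable_fun setT kern'.
Proof.
apply: measurable_fun_ifT => //; last first.
  apply: measurable_funM; first exact: (measurableT_comp (measurable_powR _)).
  apply: measurable_funM; last exact: measurableT_comp.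
  apply: measurable_funM; first exact: (measurableT_comp (measurable_powR _)).
  apply: measurableT_comp => //; apply: measurableT_comp => //.
  by apply: measurable_funM => //; exact: measurable_funX.
exact: measurable_fun_ler.
Qed.

Let kern_ge0 z : 0 <= kern z.
Proof.
rewrite /kern; case: ifP => // _.
by rewrite !mulr_ge0 // ?powR_ge0 ?expR_ge0.
Qed.

Let kern'_ge0 z : 0 <= kern' z.
Proof.
rewrite /kern'; case: ifP => // _.
by rewrite !mulr_ge0 // ?powR_ge0 ?expR_ge0.
Qed.

Local Open Scope ereal_scope.

(* Dilating x by sqrt t maps the unit ball onto |x|^2 <= t. *)
Let integral_kern_x (t : R) : (0 < t)%R ->
  \int[lebesgue_tuple K]_x (kern (t, x))%:E =
  (t `^ ((K%:R + p) / 2 - 1) * expR (- t))%:E * V.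
Proof.
move=> t0.
pose h (x : K.-tuple R) := if (enorm x <= 1)%R then f x else 0%R.
have mh : measurable_fun setT h.
  apply: measurable_fun_ifT => //.
  by apply: measurable_fun_ler => //; exact: measurable_enorm.
have h0 x : (0 <= h x)%R by rewrite /h; case: ifP.
have st0 : (0 < Num.sqrt t)%R by rewrite sqrtr_gt0.
rewrite -(ge0_integral_tscale st0); last 2 first.
- apply/measurable_EFinP/(measurableT_comp mkern).
  exact: (@pair1_measurable _ _ (measurableTypeR R) _ t).
- by move=> x; rewrite lee_fin.
have E x : kern (t, tscale (Num.sqrt t) x) =
    (t `^ (p / 2 - 1) * expR (- t) * h x)%R.
  rewrite /kern /h /= t0 /= enorm_tscale ?(ltW st0) //.
  rewrite exprMn sqr_sqrtr ?(ltW t0) // ger_pMr //.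
  rewrite -[X in (_ <= X)%R](expr1n _ 2%N) ler_sqr ?nnegrE ?enorm_ge0 //.
  by case: ifP => _; rewrite ?mulr0 // hf.
under eq_integral do rewrite E EFinM.
rewrite ge0_integralZl //; last 3 first.
- exact/measurable_EFinP.
- by move=> x _; rewrite lee_fin.
- by rewrite lee_fin mulr_ge0 ?powR_ge0 ?expR_ge0.
rewrite muleA -EFinM; congr (_%:E * _); last first.
  rewrite [RHS]integral_mkcond; apply: eq_integral => x _.
  rewrite patchE /h; case: ifPn => xb; first by rewrite ifT // inE.
  by rewrite ifF //; apply/negbTE; rewrite notin_setE /unit_ball /=; exact/negP.
rewrite sqrt_exprn ?(ltW t0) // mulrA -powRDr //.
by congr (_ `^ _ * _)%R; field.
Qed.

Let integral_kern_t (x : K.-tuple R) : enorm x != 0%R ->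
  \int[leb]_t (kern (t, x))%:E = \int[leb]_u (kern' (u, x))%:E.
Proof.
move=> x0.
have n0 : (0 < enorm x)%R by rewrite lt_neqAle eq_sym x0 enorm_ge0.
have a0 : (0 < enorm x ^+ 2)%R by rewrite exprn_gt0.
have mk : measurable_fun setT (fun t : measurableTypeR R => (kern (t, x))%:E).
  apply/measurable_EFinP/(measurableT_comp mkern).
  exact: (@pair2_measurable _ _ (measurableTypeR R) _ x).
rewrite -(@ge0_integral_affine _ (enorm x ^+ 2) 0) //; last first.
  by move=> t; rewrite lee_fin.
have maff : measurable_fun [set: measurableTypeR R]
    ((fun u => enorm x ^+ 2 * u + 0)%R : _ -> measurableTypeR R).
  by apply: measurable_funD => //; exact: measurable_funM.
have mkx := measurableT_comp mk maff.
rewrite -(ge0_integralZl _ _ mkx) //; last 2 first.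
- by move=> u _; rewrite lee_fin.
- by rewrite lee_fin ltW.
apply: eq_integral => u _; rewrite /= addr0 -EFinM; congr EFin.
rewrite /kern /kern' /= pmulr_rgt0 // ler_pMr //.
case: (lerP 1 u) => u1; last by rewrite andbF mulr0.
have u0 : (0 < u)%R by exact: lt_le_trans u1.
rewrite u0 /=.
have E : (enorm x ^+ 2 * (enorm x ^+ 2 * u) `^ (p / 2 - 1) =
          enorm x `^ p * u `^ (p / 2 - 1))%R.
  rewrite powRM ?(ltW a0) ?(ltW u0) // mulrA; congr (_ * _)%R.
  rewrite -{1}(powRr1 (ltW a0)) -powRDr // addrC subrK sqr_powR_half //.
  exact: enorm_ge0.
by rewrite (mulrC u) !mulrA E; ring.
Qed.

(* Dilating x by sqrt u turns exp (- u |x|^2) into the Gaussian weight. *)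
Let integral_kern'_x (u : R) : (1 <= u)%R ->
  \int[lebesgue_tuple K]_x (kern' (u, x))%:E =
  (u `^ (- (K%:R / 2) - 1))%:E *
  \int[lebesgue_tuple K]_x (f x * enorm x `^ p * gaussian x)%:E.
Proof.
move=> u1; have u0 : (0 < u)%R by exact: lt_le_trans u1.
have su0 : (0 < Num.sqrt u)%R by rewrite sqrtr_gt0.
pose g (x : K.-tuple R) := (enorm x `^ p * expR (- (u * enorm x ^+ 2)) * f x)%R.
have mg : measurable_fun setT g.
  apply: measurable_funM => //.
  apply: measurable_funM.
    by apply: (measurableT_comp (measurable_powR _)); exact: measurable_enorm.
  apply: measurableT_comp => //; apply: measurableT_comp => //.
  apply: measurable_funM => //; apply: measurable_funX.
  exact: measurable_enorm.
have g0 x : (0 <= g x)%R by rewrite !mulr_ge0 // ?powR_ge0 ?expR_ge0.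
have mJ : measurable_fun setT (fun x : K.-tuple R =>
    (f x * enorm x `^ p * gaussian x)%:E).
  apply/measurable_EFinP; apply: measurable_funM.
    apply: measurable_funM => //.
    by apply: (measurableT_comp (measurable_powR _)); exact: measurable_enorm.
  exact: measurable_gaussian.
rewrite -(ge0_integral_tscale su0 mJ); last first.
  by move=> x; rewrite lee_fin !mulr_ge0 // ?powR_ge0 ?gaussian_ge0.
have E x : (f (tscale (Num.sqrt u) x) * enorm (tscale (Num.sqrt u) x) `^ p *
    gaussian (tscale (Num.sqrt u) x) = u `^ (p / 2) * g x)%R.
  rewrite hf // /gaussian enorm_tscale ?(ltW su0) //.
  rewrite exprMn sqr_sqrtr ?(ltW u0) //.
  rewrite powRM ?enorm_ge0 ?(ltW su0) // -powR12_sqrt ?(ltW u0) // -powRrM /g.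
  by rewrite (mulrC (2^-1)%R); ring.
under [in RHS]eq_integral do rewrite E EFinM.
rewrite ge0_integralZl //; last 3 first.
- exact/measurable_EFinP.
- by move=> x _; rewrite lee_fin.
- by rewrite lee_fin powR_ge0.
rewrite !muleA -!EFinM sqrt_exprn ?(ltW u0) // -!powRDr //.
rewrite -ge0_integralZl //; last 3 first.
- exact/measurable_EFinP.
- by move=> x _; rewrite lee_fin.
- by rewrite lee_fin powR_ge0.
apply: eq_integral => x _; rewrite -EFinM; congr EFin.
by rewrite /kern' /= u1; congr (_ `^ _ * _)%R; field.
Qed.

(** Both sides are the integral of t^(p/2-1) e^(-t) f(x) over |x|^2 <= t.
Integrated in x first, homogeneity leaves t^((k+p)/2-1) e^(-t) times the
integral of f over the unit ball, hence a Gamma value.  Integrated in t first,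
scaling t by |x|^2 and then x by sqrt u separates a power of u from a Gaussian
moment. *)
Lemma polar_decomposition :
  eGamma ((K%:R + p) / 2) * V =
  radial_mass K *
  \int[lebesgue_tuple K]_x (f x * enorm x `^ p * gaussian x)%:E.
Proof.
set J := \int[_]_x _.
have J0 : 0 <= J.
  apply: integral_ge0 => x _.
  by rewrite lee_fin !mulr_ge0 // ?powR_ge0 ?gaussian_ge0.
have V0 : 0 <= V by apply: integral_ge0 => x _; rewrite lee_fin.
transitivity (\int[leb]_t \int[lebesgue_tuple K]_x (kern (t, x))%:E).
  rewrite /eGamma -ge0_integralZr//; last 2 first.
  - apply/measurable_EFinP; apply: measurable_funM.
      by apply: measurable_funTS; exact: measurable_powR.
    by apply: measurable_funTS; exact: measurableT_comp.
  - by move=> t _; rewrite lee_fin mulr_ge0 ?powR_ge0 ?expR_ge0.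
  rewrite integral_mkcond; apply: eq_integral => t _.
  rewrite patchE; case: ifPn => t0.
    by rewrite integral_kern_x //; move: t0; rewrite inE /= in_itv /= andbT.
  rewrite integral0_eq // => x _; rewrite /kern /= ifF //.
  by move: t0; rewrite notin_setE /= in_itv /= andbT => /negP/negbTE ->.
rewrite (fubini_tonelli (EFin \o kern)); last 2 first.
- exact/measurable_EFinP.
- by move=> z; rewrite lee_fin.
(* The substitution needs |x| > 0, hence an equality almost everywhere. *)
transitivity (\int[lebesgue_tuple K]_x \int[leb]_u (kern' (u, x))%:E).
  apply: ge0_ae_eq_integral => //.
  - exact: (measurable_fun_fubini_tonelli_G (m1 := leb) (EFin \o kern)
      (proj2 (measurable_EFinP _ _) mkern)).
  - exact: (measurable_fun_fubini_tonelli_G (m1 := leb) (EFin \o kern')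
      (proj2 (measurable_EFinP _ _) mkern')).
  - by move=> x _; apply: integral_ge0 => t _; rewrite lee_fin.
  - by move=> x _; apply: integral_ge0 => t _; rewrite lee_fin.
  exists [set x | enorm x = 0%R]; split.
  - exact: measurable_enorm_eq0.
  - exact: lebesgue_tuple_enorm_eq0.
  - move=> x /= H; apply: contrapT => /eqP x0; apply: H => _.
    exact: integral_kern_t.
rewrite -(fubini_tonelli (m1 := leb) (EFin \o kern')); last 2 first.
- exact/measurable_EFinP.
- by move=> z; rewrite lee_fin.
rewrite /radial_mass -ge0_integralZr//; last 2 first.
- by apply/measurable_EFinP; apply: measurable_funTS; exact: measurable_powR.
- by move=> t _; rewrite lee_fin powR_ge0.
rewrite [RHS]integral_mkcond; apply: eq_integral => u _.
rewrite patchE; case: ifPn => u1.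
  by rewrite integral_kern'_x //; move: u1; rewrite inE /= in_itv /= andbT.
rewrite integral0_eq // => x _; rewrite /kern' /= ifF //.
by move: u1; rewrite notin_setE /= in_itv /= andbT => /negP/negbTE ->.
Qed.

End polar_decomposition.

End polar.

(** * Integration over the sphere *)

Section uniform_measure.
Context {R : realType}.
Local Notation leb := (@lebesgue_measure R).
Local Open Scope ereal_scope.

Lemma radial_massE k : radial_mass k.+1 = (2 / k.+1%:R : R)%:E.
Proof.
set c : R := (k.+1%:R / 2)%R.
have c0 : (0 < c)%R by rewrite divr_gt0.
have dF (u : R) : (0 < u)%R ->
    is_derive u 1%R (fun u => - c^-1 * u `^ (- c))%R (u `^ (- c - 1))%R.
  move=> u0; have := is_deriveZ (- c^-1)%R (is_derive1_powR (- c)%R u0).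
  by rewrite /GRing.scale /= mulrA mulrNN mulVf ?gt_eqF // mul1r.
rewrite /radial_mass -/c.
rewrite (@ge0_continuous_FTC2y R _ (fun u => - c^-1 * u `^ (- c))%R 1%R 0%R).
- by rewrite powR1 mulr1 /c -EFinB sub0r opprK invf_div.
- by move=> u _; rewrite powR_ge0.
- apply: derivable_within_continuous => u; rewrite in_itv /= andbT => u1.
  by apply: derivable_powR; rewrite in_itv /= andbT (lt_le_trans _ u1).
- rewrite -[X in _ --> X](mulr0 (- c^-1)%R); apply: cvgMr => /=.
  apply/cvgrPdist_le => e e0; near=> u.
  have u0 : (0 < u)%R by near: u; apply: nbhs_pinfty_gt; exact: num_real.
  have ue : (e^-1 `^ (c^-1) <= u)%R.
    by near: u; apply: nbhs_pinfty_ge; exact: num_real.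
  rewrite sub0r normrN ger0_norm ?powR_ge0 // powRN.
  rewrite -(invrK e) lef_pV2 ?posrE ?invr_gt0 ?powR_gt0 //.
  have -> : (e^-1 = ((e^-1) `^ (c^-1)) `^ c)%R.
    by rewrite -powRrM mulVf ?gt_eqF // powRr1 // invr_ge0 ltW.
  apply: ge0_ler_powR; rewrite ?nnegrE ?powR_ge0 ?(ltW u0) ?(ltW c0) //.
- by move=> u u1; have [] := dF _ (lt_trans ltr01 u1).
- apply: cvg_at_right_filter; 
  have dF1 : derivable (fun u => - c^-1 * u `^ (- c))%R 1%R 1%R.
    by have [] := dF _ ltr01.
  exact: (differentiable_continuous (proj1 (derivable1_diffP _ _) dF1)).
- move=> u; rewrite in_itv /= andbT => u1.
  have u0 := lt_trans ltr01 u1; rewrite derive1E.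
  by have [_ ->] := dF _ u0.
Unshelve. all: by end_near. Qed.

Lemma pmul_gt0_lty (x y : \bar R) : 0 <= x -> 0 <= y -> 0 < x * y < +oo ->
  0 < x < +oo /\ 0 < y < +oo.
Proof.
have pinf (z : R) : (0 <= z)%R -> 0 < z%:E * +oo < +oo -> False.
  rewrite le_eqVlt => /orP[/eqP z0|z0] /andP[h1 h2].
    by rewrite -z0 mul0e ltxx in h1.
  by rewrite gt0_muley ?lte_fin // ltxx in h2.
case: x y => [x| |] [y| |] //=.
- rewrite -!EFinM !lee_fin !lte_fin !ltry !andbT => x0 y0 xy.
  have [x00|xn0] := eqVneq x 0%R; first by rewrite x00 mul0r ltxx in xy.
  have [y00|yn0] := eqVneq y 0%R; first by rewrite y00 mulr0 ltxx in xy.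
  by rewrite !lt0r xn0 yn0 x0 y0.
- by move=> x0 _ /(pinf _ x0).
- by move=> _ y0; rewrite muleC => /(pinf _ y0).
Qed.

Lemma pmule_inj (z x y : \bar R) : 0 < z < +oo -> z * x = z * y -> x = y.
Proof.
move=> /andP[z0 zy] xy.
have zfin : z \is a fin_num by rewrite ge0_fin_numE // ltW.
apply: le_anti.
by rewrite -(lee_pmul2l zfin z0) xy lexx -(lee_pmul2l zfin z0) xy lexx.
Qed.

Definition ball_volume k : \bar R := lebesgue_tuple k (@unit_ball R k).

Lemma eGamma_ge0 s : 0 <= @eGamma R s.
Proof.
apply: integral_ge0 => t _.
by rewrite lee_fin mulr_ge0 ?powR_ge0 ?expR_ge0.
Qed.

Lemma eGamma_ball_volume k :
  eGamma (k.+1%:R / 2) * ball_volume k.+1 =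
  radial_mass k.+1 * \int[lebesgue_tuple k.+1]_x (gaussian x : R)%:E.
Proof.
have := @polar_decomposition R k 0%R (cst 1%R)
  (measurable_cst _) (fun=> ler01) (fun _ _ _ => erefl).
have -> : \int[lebesgue_tuple k.+1]_(x in @unit_ball R k.+1) (cst 1%R x)%:E =
    ball_volume k.+1.
  by rewrite (integral_cst _ (@measurable_unit_ball R k.+1) 1) mul1e.
rewrite addr0 => ->; congr (_ * _); apply: eq_integral => x _.
by rewrite powRr0 !mul1r.
Qed.

(** The product of the two quantities is a positive real, being a multiple of
a Gaussian integral; as both are nonnegative, each is a positive real. *)
Lemma eGamma_ball_volume_gt0_lty k :
  0 < @eGamma R (k.+1%:R / 2) < +oo /\ 0 < ball_volume k.+1 < +oo.
Proof.
apply: pmul_gt0_lty; [exact: eGamma_ge0|exact: measure_ge0|].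
rewrite eGamma_ball_volume radial_massE.
have := integral_gaussian_gt0_lty (R := R) k.+1.
case: (integral _ _ _) => [r| |] //; last by rewrite ltxx andbF.
rewrite -EFinM !lte_fin !ltry !andbT => r0.
by rewrite mulr_gt0 // divr_gt0.
Qed.

Lemma ge0_integral_mrestr d (T : measurableType d)
    (mu : {measure set T -> \bar R}) D (mD : measurable D) (f : T -> \bar R) :
  measurable_fun setT f -> (forall x, 0 <= f x) ->
  \int[mrestr mu mD]_x f x = \int[mu]_(x in D) f x.
Proof.
move=> mf f0; rewrite -(setUv D) ge0_integral_setU //; first last.
- exact/disj_setPCl.
- exact: measurable_funS mf.
- exact: measurableC.
rewrite (eq_measure_integral mu) => [|A mA AD]; last first.
  by rewrite /= /mrestr setIidl.
rewrite [X in _ + X](eq_measure_integral mzero) => [|A mA AD]; last first.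
  have AD0 : A `&` D = set0 by rewrite disjoints_subset.
  by rewrite /= /mrestr AD0 measure0.
by rewrite integral_measure_zero adde0.
Qed.

Lemma mnormalizeE d (T : measurableType d) (mu : {measure set T -> \bar R})
    (P : probability T R) A : 0 < mu setT < +oo ->
  mnormalize mu P A = mu A * (fine (mu setT))^-1%:E.
Proof.
by move=> /andP[mu0 muy]; rewrite /mnormalize (gt_eqF mu0) (lt_eqF muy).
Qed.

(** The ball volume is moved to the left to avoid a division in the extended
reals. *)
Lemma ge0_integral_sphere_unif n (g : sphere R n -> \bar R) :
  measurable_fun setT g -> (forall y, 0 <= g y) ->
  ball_volume n.+1 * \int[sphere_unif R n]_y g y =
  \int[lebesgue_tuple n.+1]_(x in @unit_ball R n.+1) g (radial x).
Proof.
move=> mg g0.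
have [_ /andP[V0 Vy]] := eGamma_ball_volume_gt0_lty n.
have Vfin : ball_volume n.+1 \is a fin_num by rewrite ge0_fin_numE // ltW.
have iV0 : (0 <= (fine (ball_volume n.+1))^-1)%R.
  by rewrite invr_ge0 fine_ge0 // ltW.
rewrite (eq_measure_integral (pushforward (mscale (NngNum iV0)
    (mrestr (@lebesgue_tuple R n.+1) (@measurable_unit_ball R n.+1)))
  (@radial R n))); last first.
  move=> A mA _; rewrite /sphere_unif /distribution /pushforward /mscale.
  pose mu := mrestr (@lebesgue_tuple R n.+1) (@measurable_unit_ball R n.+1).
  have muT : mu setT = ball_volume n.+1.
    by rewrite /mu /mrestr setTI.
  have muT01 : 0 < mu setT < +oo by rewrite muT V0 Vy.
  have muE := @mnormalizeE _ _ mu (dirac point) (@radial R n @^-1` A) muT01.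
  apply: (etrans muE); rewrite muleC.
  exact: (congr1 (fun v => (fine v)^-1%:E * mu (@radial R n @^-1` A)) muT).
rewrite ge0_integral_pushforward // preimage_setT.
have mgr : measurable_fun setT (g \o @radial R n).
  by apply: measurableT_comp => //; exact: measurable_radial.
rewrite ge0_integral_mscale //; last by move=> x _; exact: g0.
transitivity (ball_volume n.+1 * ((fine (ball_volume n.+1))^-1%:E *
    \int[lebesgue_tuple n.+1]_(x in @unit_ball R n.+1) (g \o @radial R n) x)).
  apply: (congr1 (fun z => ball_volume n.+1 * (_ * z))).
  by apply: (ge0_integral_mrestr (@lebesgue_tuple R n.+1)) => // x; exact: g0.
rewrite muleA -{1}(fineK Vfin) -EFinM divff ?mul1e // gt_eqF //.
by rewrite fine_gt0 // V0.
Qed.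

Lemma measurable_sphere_val n : measurable_fun setT (@sphere_val R n).
Proof. by move=> _ B mB; exists B. Qed.

Lemma enorm_sphere n (y : sphere R n) : enorm y = 1%R.
Proof. exact/eqP/sphereP. Qed.

Lemma normalizeE k (x : k.-tuple R) : normalize x = tscale (enorm x)^-1 x.
Proof. by apply: eq_from_tnth => i; rewrite !tnth_mktuple mulrC. Qed.

Lemma enorm_normalize k (x : k.-tuple R) :
  enorm x != 0%R -> enorm (normalize x) = 1%R.
Proof.
by move=> x0; rewrite normalizeE enorm_tscale ?invr_ge0 ?enorm_ge0 // mulVf.
Qed.

Lemma radialE n (x : n.+1.-tuple R) : enorm x != 0%R ->
  sphere_val (radial x) = normalize x.
Proof.
by move=> x0; rewrite /radial [LHS]val_insubd enorm_normalize // eqxx.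
Qed.

Lemma tscaleA k r s (x : k.-tuple R) : tscale r (tscale s x) = tscale (r * s) x.
Proof. by apply: eq_from_tnth => i; rewrite !tnth_mktuple mulrA. Qed.

Lemma radial_tscale n r (x : n.+1.-tuple R) : (0 < r)%R ->
  radial (tscale r x) = radial x.
Proof.
move=> r0; rewrite /radial !normalizeE enorm_tscale ?ltW // tscaleA.
by rewrite invfM mulrAC mulVf ?gt_eqF // mul1r.
Qed.

Lemma ge0_integral_lebesgue_tuple_neq0 k (f g : k.+1.-tuple R -> \bar R) :
  measurable_fun setT f -> measurable_fun setT g ->
  (forall x, 0 <= f x) -> (forall x, 0 <= g x) ->
  (forall x, enorm x != 0%R -> f x = g x) ->
  \int[lebesgue_tuple k.+1]_x f x = \int[lebesgue_tuple k.+1]_x g x.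
Proof.
move=> mf mg f0 g0 fg; apply: ge0_ae_eq_integral => //.
exists [set x | enorm x = 0%R]; split.
- exact: measurable_enorm_eq0.
- exact: lebesgue_tuple_enorm_eq0.
- by move=> x /= H; apply: contrapT => /eqP x0; apply: H => _; exact: fg.
Qed.

(** The direction of a Gaussian vector is uniform and independent of its
length. *)
Lemma sphere_gaussian n (p : R) (h : sphere R n -> R) :
  measurable_fun setT h -> (forall y, (0 <= h y)%R) ->
  eGamma ((n.+1%:R + p) / 2) *
    (ball_volume n.+1 * \int[sphere_unif R n]_y (h y)%:E) =
  radial_mass n.+1 *
  \int[lebesgue_tuple n.+1]_x (h (radial x) * enorm x `^ p * gaussian x)%:E.
Proof.
move=> mh h0; rewrite ge0_integral_sphere_unif //; last exact/measurable_EFinP.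
rewrite -polar_decomposition //.
- by apply: measurableT_comp => //; exact: measurable_radial.
- by move=> r x r0; rewrite radial_tscale.
Qed.

End uniform_measure.

(** * Orthogonal invariance *)

Section orthogonal.
Context {R : realType}.
Implicit Types k : nat.

Definition vec k (x : k.-tuple R) : 'cV[R]_k := \col_i tnth x i.

Definition mxact k (P : 'M[R]_k) (x : k.-tuple R) : k.-tuple R :=
  [tuple (P *m vec x) i 0 | i < k].

Definition orthogonal_mx k (P : 'M[R]_k) := P^T *m P = 1%:M.

Lemma vec_inj k : injective (@vec k).
Proof.
move=> x y /matrixP xy; apply: eq_from_tnth => i.
by have := xy i 0; rewrite !mxE.
Qed.

Lemma vec_mxact k P (x : k.-tuple R) : vec (mxact P x) = P *m vec x.
Proof. by apply/matrixP => i j; rewrite mxE tnth_mktuple (ord1 j). Qed.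

Lemma vec_tadd k (x a : k.-tuple R) : vec (tadd x a) = vec x + vec a.
Proof. by apply/matrixP => i j; rewrite !mxE tnth_mktuple. Qed.

Lemma vec_tscale k r (x : k.-tuple R) : vec (tscale r x) = r *: vec x.
Proof. by apply/matrixP => i j; rewrite !mxE tnth_mktuple. Qed.

Lemma sqr_enorm_vec k (x : k.-tuple R) :
  enorm x ^+ 2 = ((vec x)^T *m vec x) 0 0.
Proof.
rewrite sqr_enorm mxE; apply: eq_bigr => i _.
by rewrite !mxE expr2.
Qed.

Lemma orthogonal_mxC k (P : 'M[R]_k) : orthogonal_mx P -> P *m P^T = 1%:M.
Proof. exact: mulmx1C. Qed.

Lemma eq_enorm k l (x : k.-tuple R) (y : l.-tuple R) :
  enorm x ^+ 2 = enorm y ^+ 2 -> enorm x = enorm y.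
Proof.
by move=> /eqP; rewrite eqrXn2 ?enorm_ge0 // => /eqP.
Qed.

Lemma in_unit_ball k (x : k.-tuple R) :
  (x \in @unit_ball R k) = (enorm x <= 1).
Proof. by apply/idP/idP; rewrite inE. Qed.

Lemma enorm_mxact k (P : 'M[R]_k) x : orthogonal_mx P ->
  enorm (mxact P x) = enorm x.
Proof.
move=> oP; apply: eq_enorm.
by rewrite !sqr_enorm_vec vec_mxact trmx_mul mulmxA -(mulmxA _ P^T) oP mulmx1.
Qed.

Lemma measurable_mxact k (P : 'M[R]_k) : measurable_fun setT (mxact P).
Proof.
apply/measurable_fun_tnthP => i.
rewrite (_ : _ \o _ = fun x => \sum_j P i j * tnth x j); last first.
  apply/funext => x /=; rewrite tnth_mktuple mxE; apply: eq_bigr => j _.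
  by rewrite mxE.
apply: measurable_sum => j; apply: measurable_funM => //.
exact: measurable_tnth.
Qed.

Local Open Scope ereal_scope.

(** The uniqueness argument for Haar measure, with the unit ball as the test
set: translations turn the product of the integrals of b and f o P into the
double integral of b(x) f(P y + x), then of b(x - P y) f(x), and since P
preserves the norm b(x - P y) = b(P^T x - y) = b(y - P^T x), whose integral in y
is again the volume of the ball. *)
Lemma ge0_integral_mxact k (P : 'M[R]_k.+1) (f : k.+1.-tuple R -> \bar R) :
  orthogonal_mx P -> measurable_fun setT f -> (forall x, 0 <= f x) ->
  \int[lebesgue_tuple k.+1]_x f (mxact P x) = \int[lebesgue_tuple k.+1]_x f x.
Proof.
move=> oP mf f0; set L := @lebesgue_tuple R k.+1.
have oPT := orthogonal_mxC oP.
pose b (x : k.+1.-tuple R) : \bar R := (\1_(@unit_ball R k.+1) x)%:E.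
have mb : measurable_fun setT b.
  apply/measurable_EFinP; apply: measurable_indic.
  exact: measurable_unit_ball.
have b0 x : 0 <= b x by rewrite lee_fin.
have beq x y : enorm x = enorm y -> b x = b y.
  by move=> xy; rewrite /b !indicE !in_unit_ball xy.
have Vb : \int[L]_x b x = ball_volume k.+1.
  by rewrite integral_indic ?setIT //; exact: measurable_unit_ball.
have [_ V0y] := eGamma_ball_volume_gt0_lty (R := R) k.
have mfP : measurable_fun setT (f \o mxact P).
  by apply: measurableT_comp => //; exact: measurable_mxact.
suff E : ball_volume k.+1 * \int[L]_x f (mxact P x) =
         ball_volume k.+1 * \int[L]_x f x.
  exact: pmule_inj E.
have mtr : measurable_fun setT
    (fun z : k.+1.-tuple R * k.+1.-tuple R => tadd z.1 (mxact P z.2)).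
  apply: measurable_tadd => //.
  exact: (measurableT_comp (measurable_mxact P)).
have mtr' : measurable_fun setT
    (fun z : k.+1.-tuple R * k.+1.-tuple R =>
      tadd z.1 (tscale (-1) (mxact P z.2))).
  apply: measurable_tadd => //.
  apply: (measurableT_comp (measurable_tscaler _)).
  exact: (measurableT_comp (measurable_mxact P)).
have addK (x a : k.+1.-tuple R) : tadd (tadd x (tscale (-1) a)) a = x.
  by apply: vec_inj; rewrite !vec_tadd vec_tscale scaleN1r subrK.
have I0 : 0 <= \int[L]_x f (mxact P x) by apply: integral_ge0 => x _; exact: f0.
rewrite -[in LHS]Vb -ge0_integralZr //.
transitivity (\int[L]_x \int[L]_y (b x * f (tadd x (mxact P y)))).
  apply: eq_integral => x _.
  rewrite -(ge0_integral_tadd (mxact P^T x) mfP (fun=> f0 _)) /=.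
  under [in LHS]eq_integral => y _.
    have -> : mxact P (tadd y (mxact P^T x)) = tadd x (mxact P y).
      apply: vec_inj; rewrite !vec_tadd !vec_mxact vec_tadd vec_mxact mulmxDr.
      by rewrite mulmxA oPT mul1mx addrC.
    over.
  rewrite ge0_integralZl //.
  apply: (measurableT_comp mf).
  exact: (measurableT_comp mtr (pair1_measurable x)).
rewrite (fubini_tonelli
    (fun z => b z.1 * f (tadd z.1 (mxact P z.2)))); last 2 first.
- apply: emeasurable_funM; last exact: (measurableT_comp mf).
  exact: (measurableT_comp mb).
- by move=> z; exact: mule_ge0.
transitivity (\int[L]_y \int[L]_x (b (tadd x (tscale (-1) (mxact P y))) * f x)).
  apply: eq_integral => y _ /=.
  rewrite -[LHS](@ge0_integral_tadd _ _ (tscale (-1) (mxact P y)));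
    last 2 first.
  - apply: emeasurable_funM => //; apply: (measurableT_comp mf).
    exact: measurable_taddr.
  - by move=> x; exact: mule_ge0.
  by apply: eq_integral => x _; rewrite addK.
rewrite -(fubini_tonelli
    (fun z => b (tadd z.1 (tscale (-1) (mxact P z.2))) * f z.1)); last 2 first.
- apply: emeasurable_funM; first exact: (measurableT_comp mb).
  exact: (measurableT_comp mf).
- by move=> z; exact: mule_ge0.
rewrite -ge0_integralZl //.
apply: eq_integral => x _ /=.
rewrite ge0_integralZr //; last first.
  apply: (measurableT_comp mb).
  exact: (measurableT_comp mtr' (pair1_measurable x)).
congr (_ * _); rewrite -Vb.
rewrite -[RHS](ge0_integral_tadd (tscale (-1) (mxact P^T x)) mb b0).
apply: eq_integral => y _; apply: beq.
rewrite -(enorm_mxact (tadd y _) oP); apply: eq_enorm; rewrite !sqr_enorm_vec.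
have -> : vec (mxact P (tadd y (tscale (-1) (mxact P^T x)))) =
          (- vec (tadd x (tscale (-1) (mxact P y))))%R.
  rewrite !(vec_mxact, vec_tadd, vec_tscale) !scaleN1r opprD opprK.
  by rewrite mulmxDr mulmxN mulmxA oPT mul1mx addrC.
by rewrite mulmxN [X in (- (X *m _))%R]linearN mulNmx opprK.
Qed.

Lemma ge0_sphere_unif_mxact n (P : 'M[R]_n.+1) (g : n.+1.-tuple R -> \bar R) :
  orthogonal_mx P -> measurable_fun setT g -> (forall x, 0 <= g x) ->
  \int[sphere_unif R n]_y g (mxact P y) = \int[sphere_unif R n]_y g y.
Proof.
move=> oP mg g0.
have [_ V0y] := eGamma_ball_volume_gt0_lty (R := R) n.
have mval := @measurable_sphere_val R n.
suff E : ball_volume n.+1 * \int[sphere_unif R n]_y g (mxact P y) =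
         ball_volume n.+1 * \int[sphere_unif R n]_y g y.
  exact: pmule_inj E.
have mgP : measurable_fun setT (g \o mxact P).
  by apply: measurableT_comp => //; exact: measurable_mxact.
rewrite !ge0_integral_sphere_unif //; last 2 first.
- exact: (measurableT_comp mg).
- exact: (measurableT_comp mgP).
pose h x := ((fun x => g (radial x)) \_ (@unit_ball R n.+1)) x.
have mgr : measurable_fun setT (fun x => g (@radial R n x)).
  apply: (measurableT_comp mg); apply: (measurableT_comp mval).
  exact: measurable_radial.
have mh : measurable_fun setT h.
  apply/(measurable_restrictT _ _).1; first exact: measurable_unit_ball.
  exact: measurable_funS mgr.
rewrite [LHS]integral_mkcond [RHS]integral_mkcond.
rewrite -[RHS](ge0_integral_mxact (P := P)) //; last first.
  by move=> x; rewrite erestrict_ge0.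
apply: ge0_integral_lebesgue_tuple_neq0.
- apply/(measurable_restrictT _ _).1; first exact: measurable_unit_ball.
  apply: measurable_funTS.
  apply: (measurableT_comp mgP); apply: (measurableT_comp mval).
  exact: measurable_radial.
- by apply: (measurableT_comp mh); exact: measurable_mxact.
- by move=> x; rewrite erestrict_ge0.
- by move=> x; rewrite erestrict_ge0.
move=> x x0; rewrite !patchE.
have -> : (mxact P x \in @unit_ball R n.+1) = (x \in @unit_ball R n.+1).
  by rewrite !in_unit_ball enorm_mxact.
case: ifP => // _; congr g.
rewrite !radialE ?enorm_mxact // !normalizeE enorm_mxact //.
by apply: vec_inj; rewrite !(vec_mxact, vec_tscale) scalemxAr.
Qed.

End orthogonal.

(** * Triangularization by orthogonal matrices *)

Section householder.
Context {R : realType}.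

Definition sqr_frob p q (M : 'M[R]_(p, q)) : R := \sum_i \sum_j M i j ^+ 2.

Lemma sqr_frobE p q (M : 'M[R]_(p, q)) : sqr_frob M = \tr (M *m M^T).
Proof.
rewrite /mxtrace; apply: eq_bigr => i _; rewrite mxE.
by apply: eq_bigr => j _; rewrite mxE expr2.
Qed.

Lemma sqr_frob_ge0 p q (M : 'M[R]_(p, q)) : 0 <= sqr_frob M.
Proof. by apply: sumr_ge0 => i _; apply: sumr_ge0 => j _; exact: sqr_ge0. Qed.

Lemma sqr_frob_orthogonal p q (M : 'M[R]_(p, q)) (P : 'M[R]_q) :
  orthogonal_mx P -> sqr_frob (M *m P) = sqr_frob M.
Proof.
move=> oP; rewrite !sqr_frobE trmx_mul mulmxA -(mulmxA M).
by rewrite orthogonal_mxC // mulmx1.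
Qed.

Lemma orthogonal_mxM k (P Q : 'M[R]_k) :
  orthogonal_mx P -> orthogonal_mx Q -> orthogonal_mx (P *m Q).
Proof.
move=> oP oQ; rewrite /orthogonal_mx trmx_mul mulmxA -(mulmxA _ P^T).
by rewrite oP mulmx1.
Qed.

Lemma orthogonal_reflection k (u : 'rV[R]_k) s : u *m u^T = s%:M -> s != 0 ->
  orthogonal_mx (1%:M - (2 / s) *: (u^T *m u)).
Proof.
move=> us s0; rewrite /orthogonal_mx.
have -> : (1%:M - (2 / s) *: (u^T *m u))^T = 1%:M - (2 / s) *: (u^T *m u).
  by rewrite linearB linearZ /= trmx1 trmx_mul trmxK.
have AA : u^T *m u *m (u^T *m u) = s *: (u^T *m u).
  by rewrite -mulmxA (mulmxA u) us mul_scalar_mx -scalemxAr.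
have E : 2 / s * (2 / s * s) = 2 / s + 2 / s by field.
rewrite mulmxBl mul1mx mulmxBr mulmx1 -scalemxAl -scalemxAr AA !scalerA.
by rewrite -mulrA E scalerDl opprB addrK subrK.
Qed.

(** With a = |v| and u = v - a e_0, one has <u, u> = 2 <v, u>, so the
reflection along u maps v to v - u = a e_0. *)
Lemma householder k (v : 'rV[R]_k.+1) : exists2 H : 'M[R]_k.+1,
  orthogonal_mx H & exists a, v *m H = a *: delta_mx 0 0.
Proof.
pose dot (x y : 'rV[R]_k.+1) := (x *m y^T) 0 0.
have dotE x y : x *m y^T = (dot x y)%:M by rewrite [LHS]mx11_scalar.
pose a := Num.sqrt (dot v v).
have a2 : a ^+ 2 = dot v v.
  rewrite sqr_sqrtr // /dot mxE sumr_ge0 // => i _.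
  by rewrite mxE -expr2 sqr_ge0.
pose e : 'rV[R]_k.+1 := delta_mx 0 0.
have ee : dot e e = 1.
  rewrite /dot mxE (bigD1 ord0) //= big1 => [|i i0];
    rewrite !mxE ?eqxx ?mul1r ?addr0 //.
  by rewrite (negPf i0) mul0r.
have ev : dot e v = dot v e.
  by rewrite /dot !mxE; apply: eq_bigr => i _; rewrite !mxE mulrC.
pose u := v - a *: e.
have vu : dot v u = a ^+ 2 - a * dot v e.
  by rewrite a2 /u /dot linearB linearZ /= mulmxBr -scalemxAr !mxE.
have uu : dot u u = 2 * dot v u.
  have -> : dot u u = dot v u - a * dot e u.
    by rewrite {1}/u /dot mulmxBl -scalemxAl !mxE.
  have -> : dot e u = dot v e - a.
    rewrite /u /dot linearB linearZ /= mulmxBr -scalemxAr mxE [X in _ + X]mxE.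
    by rewrite [X in - X]mxE -/(dot e v) -/(dot e e) ev ee mulr1.
  by rewrite vu; ring.
have [u0|u0] := eqVneq (dot u u) 0.
  exists 1%:M; first by rewrite /orthogonal_mx trmx1 mulmx1.
  exists a; rewrite mulmx1; apply/eqP; rewrite -subr_eq0 -/u.
  apply/eqP/rowP => i; rewrite mxE.
  have uu2 : \sum_j u 0 j ^+ 2 = 0.
    rewrite -[RHS]u0 /dot mxE; apply: eq_bigr => j _.
    by rewrite [u^T _ _]mxE expr2.
  have := psumr_eq0P (fun j _ => sqr_ge0 (u 0 j)) uu2 (i := i) isT.
  by move=> /eqP; rewrite sqrf_eq0 mxE => /eqP ->; rewrite mxE.
exists (1%:M - (2 / dot u u) *: (u^T *m u)).
  exact: orthogonal_reflection (dotE u u) u0.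
exists a; rewrite mulmxBr mulmx1 -scalemxAr mulmxA dotE mul_scalar_mx scalerA.
rewrite uu invfM mulrA divff ?mul1r //.
rewrite mulVf ?scale1r; last first.
  by apply: contraNneq u0; rewrite uu => ->; rewrite mulr0.
by rewrite /u opprB addrC subrK.
Qed.

(** A reflection makes the first row a multiple of e_0; the remaining rows are
handled by induction, acting on the remaining columns only. *)
Lemma lower_trapezoidal p k (M : 'M[R]_(p, k)) : exists2 P : 'M[R]_k,
  orthogonal_mx P & forall i (j : 'I_k), (p <= j)%N -> (M *m P) i j = 0.
Proof.
elim: p k M => [|p IH] k M.
  by exists 1%:M => [|[]//]; rewrite /orthogonal_mx trmx1 mulmx1.
case: k M => [|k] M.
  by exists 1%:M => [|? []//]; rewrite /orthogonal_mx trmx1 mulmx1.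
have [H oH [a vH]] := householder (row 0 M).
pose N : 'M[R]_(1 + p, 1 + k) := M *m H.
have [Q oQ Q0] := IH k (drsubmx N).
pose Q1 : 'M[R]_(1 + k) := block_mx 1%:M 0 0 Q.
have oQ1 : orthogonal_mx Q1.
  rewrite /orthogonal_mx /Q1 tr_block_mx trmx1 !trmx0 mulmx_block.
  rewrite !(mulmx0, mul0mx, addr0, add0r) mulmx1.
  by have -> : Q^T *m Q = 1%:M by []; rewrite -scalar_mx_block.
exists (H *m (Q1 : 'M[R]_k.+1)); first exact: orthogonal_mxM.
move=> i j pj; rewrite mulmxA.
have NQ : N *m Q1 = row_mx (lsubmx N) (rsubmx N *m Q).
  rewrite -[in LHS](hsubmxK N) /Q1 mul_row_block.
  by rewrite !(mulmx0, mul0mx, addr0, add0r, mulmx1).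
have j0 : j != ord0 by apply: contraTneq pj => ->.
have [j' jE] : exists j' : 'I_k, j = rshift 1 j'.
  by case: (unliftP ord0 j) j0 => [j' ->|->] // _; exists j'; apply: val_inj.
have {}pj : (p <= j')%N by move: pj; rewrite jE.
transitivity (row_mx (lsubmx N) (rsubmx N *m Q) (i : 'I_(1 + p)) (rshift 1 j')).
  by rewrite -NQ jE.
rewrite row_mxEr -(vsubmxK (rsubmx N)) mul_col_mx.
have N0 : usubmx (rsubmx N) = 0.
  apply/matrixP => r c; rewrite [LHS]mxE [LHS]mxE [RHS]mxE.
  have -> : lshift p r = ord0 by rewrite (ord1 r); exact: val_inj.
  have -> : N ord0 (rshift 1 c) = row 0 (M *m H) 0 (rshift 1 c).
    by rewrite [RHS]mxE.
  by rewrite row_mul vH !mxE /= mulr0.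
rewrite N0 mul0mx.
have -> : dsubmx (rsubmx N) = drsubmx N.
  by apply/matrixP => r c; rewrite !mxE.
case: (split_ordP (i : 'I_(1 + p))) => i' ->.
  by rewrite col_mxEu mxE.
by rewrite col_mxEd Q0.
Qed.

End householder.

(** * Integrals of bounded functions *)

Section bounded_measurable.
Context {R : realType} {d} {T : measurableType d}.
Implicit Types f g : T -> R.

(** Every function met on the spheres is of this kind, which makes the
real-valued integral against a probability linear without further
conditions. *)
Definition bounded_measurable f :=
  measurable_fun setT f /\ exists M, forall x, `|f x| <= M.

Lemma bounded_measurable_cst r : bounded_measurable (fun=> r).
Proof. by split; [exact: measurable_cst|exists `|r|]. Qed.

Lemma bounded_measurableD f g : bounded_measurable f -> bounded_measurable g ->
  bounded_measurable (fun x => f x + g x).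
Proof.
move=> [mf [a fa]] [mg [b gb]]; split; first exact: measurable_funD.
by exists (a + b) => x; rewrite (le_trans (ler_normD _ _)) // lerD.
Qed.

Lemma bounded_measurableM f g : bounded_measurable f -> bounded_measurable g ->
  bounded_measurable (fun x => f x * g x).
Proof.
move=> [mf [a fa]] [mg [b gb]]; split; first exact: measurable_funM.
by exists (a * b) => x; rewrite normrM ler_pM.
Qed.

Lemma bounded_measurable_sum (I : Type) (s : seq I) (h : I -> T -> R) :
  (forall i, bounded_measurable (h i)) ->
  bounded_measurable (fun x => \sum_(i <- s) h i x).
Proof.
move=> hb; elim: s => [|i s IH].
  under [X in bounded_measurable X]eq_fun do rewrite big_nil.
  exact: bounded_measurable_cst.
under [X in bounded_measurable X]eq_fun do rewrite big_cons.
exact: bounded_measurableD.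
Qed.

Variable P : probability T R.

Lemma bounded_measurable_integrable f : bounded_measurable f ->
  P.-integrable setT (EFin \o f).
Proof.
move=> [mf [M fM]]; have PT : (P setT < +oo)%E by rewrite probability_setT ltry.
apply: (measurable_bounded_integrable _ PT mf) => //.
exists M; split; first exact: num_real.
by move=> N MN x _; exact: le_trans (fM x) (ltW MN).
Qed.

Lemma EFin_Rintegral f : bounded_measurable f ->
  (\int[P]_x (f x)%:E)%E = (\int[P]_x f x)%:E.
Proof.
move=> bf; rewrite fineK //; apply: integrable_fin_num => //.
exact: bounded_measurable_integrable.
Qed.

Lemma bounded_RintegralD f g : bounded_measurable f -> bounded_measurable g ->
  \int[P]_x (f x + g x) = \int[P]_x f x + \int[P]_x g x.
Proof.
by move=> bf bg; rewrite RintegralD //; exact: bounded_measurable_integrable.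
Qed.

Lemma bounded_RintegralZl r f : bounded_measurable f ->
  \int[P]_x (r * f x) = r * \int[P]_x f x.
Proof.
by move=> bf; rewrite RintegralZl //; exact: bounded_measurable_integrable.
Qed.

Lemma bounded_Rintegral_sum (I : Type) (s : seq I) (h : I -> T -> R) :
  (forall i, bounded_measurable (h i)) ->
  \int[P]_x (\sum_(i <- s) h i x) = \sum_(i <- s) \int[P]_x h i x.
Proof.
move=> hb; elim: s => [|i s IH].
  rewrite big_nil; under eq_Rintegral do rewrite big_nil.
  by rewrite Rintegral_cst // mul0r.
rewrite big_cons -IH; under eq_Rintegral do rewrite big_cons.
by rewrite bounded_RintegralD //; exact: bounded_measurable_sum.
Qed.

Lemma bounded_le_Rintegral f g : bounded_measurable f -> bounded_measurable g ->
  (forall x, f x <= g x) -> \int[P]_x f x <= \int[P]_x g x.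
Proof.
move=> bf bg fg.
by apply: le_Rintegral => //; exact: bounded_measurable_integrable.
Qed.

End bounded_measurable.

Lemma bounded_measurable_comp {R : realType} d1 d2 (T1 : measurableType d1)
    (T2 : measurableType d2) (f : T2 -> R) (phi : T1 -> T2) :
  measurable_fun setT phi -> bounded_measurable f ->
  bounded_measurable (fun x => f (phi x)).
Proof.
move=> mphi [mf [M fM]]; split; first exact: (measurableT_comp mf).
by exists M => x.
Qed.

(** Image measures, as a property of nonnegative integrals: it extends to signed
integrands through their positive and negative parts. *)
Lemma Rintegral_transfer {R : realType} d1 d2 (T1 : measurableType d1)
    (T2 : measurableType d2) (P : probability T1 R) (Q : probability T2 R)
    (phi : T1 -> T2) (f : T2 -> R) :
  (forall g : T2 -> \bar R, measurable_fun setT g -> (forall x, 0 <= g x)%E ->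
    (\int[P]_x g (phi x) = \int[Q]_y g y)%E) ->
  measurable_fun setT f -> \int[P]_x f (phi x) = \int[Q]_y f y.
Proof.
move=> PQ mf; congr fine; rewrite [LHS]integralE [RHS]integralE.
have mEf : measurable_fun setT (EFin \o f) by exact/measurable_EFinP.
congr (_ - _)%E.
- rewrite -(PQ (EFin \o f)^\+%E); [|exact: measurable_funepos|by []].
  by apply: eq_integral => x _; rewrite !funeposE.
- rewrite -(PQ (EFin \o f)^\-%E); [|exact: measurable_funeneg|by []].
  by apply: eq_integral => x _; rewrite !funenegE.
Qed.

Lemma ge0_integral_marginal {R : realType} d1 d2 (T1 : measurableType d1)
    (T2 : measurableType d2) (P : probability T1 R) (Q : probability T2 R)
    (phi : T1 -> T2) (g : T2 -> \bar R) : measurable_fun setT phi ->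
  (forall A, measurable A -> P (phi @^-1` A) = Q A) ->
  measurable_fun setT g -> (forall x, 0 <= g x)%E ->
  (\int[P]_x g (phi x) = \int[Q]_y g y)%E.
Proof.
move=> mphi PQ mg g0.
rewrite [RHS](eq_measure_integral (pushforward P phi)) => [|A mA _].
  by rewrite ge0_integral_pushforward.
exact/esym/PQ.
Qed.

(** * The first coordinates of a uniform point *)

Section equatorial_mean.
Context {R : realType}.

Lemma first_coords_tscale m n r (x : n.-tuple R) :
  first_coords m (tscale r x) = tscale r (first_coords m x).
Proof.
apply: eq_from_tnth => i; rewrite !tnth_mktuple.
have [lt|ge] := ltnP i n; last by rewrite !nth_default ?size_tuple ?mulr0.
by rewrite -!(tnth_nth 0 _ (Ordinal lt)) tnth_mktuple.
Qed.

Lemma ler_enorm_first_coords m n (x : n.-tuple R) : (m <= n)%N ->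
  enorm (first_coords m x) <= enorm x.
Proof.
move=> mn; rewrite ler_sqrt ?sumr_ge0 // => [|i _]; last exact: sqr_ge0.
under eq_bigr do rewrite tnth_mktuple.
under [leRHS]eq_bigr do rewrite (tnth_nth 0).
rewrite (big_ord_widen n (fun i => nth 0 x i ^+ 2) mn).
rewrite [leRHS](bigID (fun i : 'I_n => (i < m)%N)) /= lerDl sumr_ge0 // => i _.
exact: sqr_ge0.
Qed.

Lemma bounded_enorm_first_coords m n : (m <= n)%N ->
  bounded_measurable (fun y : sphere R n => enorm (first_coords m.+1 y)).
Proof.
move=> mn; split.
  apply: (measurableT_comp (@measurable_enorm R m.+1)).
  apply: (measurableT_comp (@measurable_first_coords R m.+1 n.+1)).
  exact: measurable_sphere_val.
exists 1 => y; rewrite ger0_norm ?enorm_ge0 // -(enorm_sphere y).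
exact: ler_enorm_first_coords.
Qed.

Lemma Gamma_gt0 k : 0 < Gamma (k.+1%:R / 2) :> R.
Proof. by have [/fine_gt0] := eGamma_ball_volume_gt0_lty (R := R) k. Qed.

Lemma eGammaE k : eGamma (k.+1%:R / 2) = (Gamma (k.+1%:R / 2))%:E :> \bar R.
Proof.
have [/andP[G0 Gy] _] := eGamma_ball_volume_gt0_lty (R := R) k.
by rewrite -[LHS]fineK // ge0_fin_numE // ltW.
Qed.

Local Open Scope ereal_scope.

(** The form of the polar decomposition for functions homogeneous of degree p:
the value at x is |x|^p times the value at its direction. *)
Lemma sphere_gaussian_homogeneous n (p : R) (G : n.+1.-tuple R -> R) :
  measurable_fun setT G -> (forall x, (0 <= G x)%R) ->
  (forall r x, (0 < r)%R -> G (tscale r x) = (r `^ p * G x)%R) ->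
  eGamma ((n.+1%:R + p) / 2) *
    (ball_volume n.+1 * \int[sphere_unif R n]_y (G y)%:E) =
  radial_mass n.+1 * \int[lebesgue_tuple n.+1]_x (G x * gaussian x)%:E.
Proof.
move=> mG G0 hG.
have mGs : measurable_fun setT (fun y : sphere R n => G y).
  exact: (measurableT_comp mG (@measurable_sphere_val R n)).
rewrite (sphere_gaussian _ mGs) //; congr (_ * _).
apply: ge0_integral_lebesgue_tuple_neq0.
- apply/measurable_EFinP; apply: measurable_funM.
    apply: measurable_funM.
      by apply: (measurableT_comp mGs); exact: measurable_radial.
    by apply: (measurableT_comp (measurable_powR _)); exact: measurable_enorm.
  exact: measurable_gaussian.
- apply/measurable_EFinP; apply: measurable_funM => //.
  exact: measurable_gaussian.
- by move=> x; rewrite lee_fin !mulr_ge0 ?powR_ge0 ?gaussian_ge0.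
- by move=> x; rewrite lee_fin !mulr_ge0 ?gaussian_ge0.
move=> x x0; congr (_ * _)%:E; rewrite radialE // normalizeE.
have n0 : (0 < enorm x)%R by rewrite lt_neqAle eq_sym x0 enorm_ge0.
rewrite hG ?invr_gt0 // mulrAC -powRM ?invr_ge0 ?enorm_ge0 //.
by rewrite mulVf // powR1 mul1r.
Qed.

Lemma gaussian_first_factor m n : (m <= n)%N -> exists I : R, (0 < I)%R /\
  forall F : m.+1.-tuple R -> R, measurable_fun setT F ->
    (forall x, (0 <= F x)%R) ->
    \int[lebesgue_tuple n.+1]_x (F (first_coords m.+1 x) * gaussian x)%:E =
    \int[lebesgue_tuple m.+1]_x (F x * gaussian x)%:E * I%:E.
Proof.
move=> /subnKC <-; set b := (n - m)%N.
have /andP[I0 Iy] := integral_gaussian_gt0_lty (R := R) b.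
exists (fine (\int[lebesgue_tuple b]_x (gaussian x : R)%:E)).
split; first by rewrite fine_gt0 // I0.
move=> F mF F0; rewrite fineK; last by rewrite ge0_fin_numE // ltW.
under eq_integral do rewrite EFinM.
under [in RHS]eq_integral do rewrite EFinM.
apply: (@ge0_integral_gaussian_first _ m.+1 b (EFin \o F)).
  exact/measurable_EFinP.
by move=> x; rewrite lee_fin.
Qed.

Section mean.
Variables (m n : nat) (hmn : (m <= n)%N).

Let gauss k : R := fine (\int[lebesgue_tuple k]_x (gaussian x : R)%:E).

Let gauss_gt0 k : (0 < gauss k)%R.
Proof. exact: fine_gt0 (integral_gaussian_gt0_lty k). Qed.

Let gaussE k : \int[lebesgue_tuple k]_x (gaussian x)%:E = (gauss k)%:E.
Proof.
have /andP[I0 Iy] := integral_gaussian_gt0_lty (R := R) k.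
by rewrite fineK // ge0_fin_numE // ltW.
Qed.

Let gauss_factor : exists I : R,
  [/\ (0 < I)%R, gauss n.+1 = (gauss m.+1 * I)%R &
  forall F : m.+1.-tuple R -> R, measurable_fun setT F ->
    (forall x, (0 <= F x)%R) ->
    \int[lebesgue_tuple n.+1]_x (F (first_coords m.+1 x) * gaussian x)%:E =
    \int[lebesgue_tuple m.+1]_x (F x * gaussian x)%:E * I%:E].
Proof.
have [I [I0 HI]] := gaussian_first_factor hmn; exists I; split => //.
apply: EFin_inj; rewrite EFinM -!gaussE.
transitivity (\int[lebesgue_tuple n.+1]_x
    (cst (1%R : R) (first_coords m.+1 x) * gaussian x)%:E).
  by apply: eq_integral => x _; rewrite /= mul1r.
rewrite (HI (cst 1%R) (measurable_cst _) (fun=> ler01)); congr (_ * _).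
by apply: eq_integral => x _; rewrite /= mul1r.
Qed.

Lemma first_coords_homogeneous p (F : m.+1.-tuple R -> R) :
  (forall r x, (0 < r)%R -> F (tscale r x) = (r `^ p * F x)%R) ->
  forall r (x : n.+1.-tuple R), (0 < r)%R ->
    F (first_coords m.+1 (tscale r x)) = (r `^ p * F (first_coords m.+1 x))%R.
Proof. by move=> hF r x r0; rewrite first_coords_tscale hF. Qed.

(** For F homogeneous of degree 0 this says that the normalized first
coordinates of a uniform point are again uniform.  Both means are quotients of
Gaussian integrals, which differ by the factor of the discarded coordinates. *)
Lemma ge0_sphere_unif_first_coords (F : m.+1.-tuple R -> R) :
  measurable_fun setT F -> (forall x, (0 <= F x)%R) -> homogeneous0 F ->
  \int[sphere_unif R n]_y (F (first_coords m.+1 y))%:E =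
  \int[sphere_unif R m]_y (F y)%:E.
Proof.
move=> mF F0 hF; have [I [I0 gI HI]] := gauss_factor.
have hF' r x : (0 < r)%R -> F (tscale r x) = (r `^ 0 * F x)%R.
  by move=> r0; rewrite powRr0 mul1r hF.
have mFf : measurable_fun setT (F \o @first_coords R m.+1 n.+1).
  by apply: (measurableT_comp mF); exact: measurable_first_coords.
have := sphere_gaussian_homogeneous mFf (fun=> F0 _)
  (first_coords_homogeneous hF').
have := sphere_gaussian_homogeneous mF F0 hF'.
rewrite (HI _ mF F0) addr0 addr0 2!muleA 2!eGamma_ball_volume 2!gaussE gI.
rewrite 2!radial_massE.
set J := \int[_]_x _; rewrite -!muleA.
have rm0 k : 0 < (2 / k.+1%:R : R)%:E < +oo by rewrite lte_fin divr_gt0 ?ltry.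
move=> /(pmule_inj (rm0 _)) <- /(pmule_inj (rm0 _)).
rewrite EFinM -!muleA [_ * I%:E]muleC.
have gm0 : 0 < (gauss m.+1)%:E < +oo by rewrite lte_fin gauss_gt0 ltry.
have I0y : 0 < I%:E < +oo by rewrite lte_fin I0 ltry.
by move=> /(pmule_inj gm0) /(pmule_inj I0y).
Qed.

(** The indicator of the origin is homogeneous of degree 0, and it vanishes on
the smaller sphere. *)
Lemma sphere_unif_first_coords_neq0 :
  sphere_unif R n [set y : sphere R n | enorm (first_coords m.+1 y) = 0%R] = 0.
Proof.
pose Z := [set x : m.+1.-tuple R | enorm x = 0%R].
have mZ : measurable Z by exact: measurable_enorm_eq0.
have mind : measurable_fun setT (\1_Z : m.+1.-tuple R -> R).
  exact: measurable_indic.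
have mf : measurable_fun setT (fun y : sphere R n => first_coords m.+1 y).
  apply: (measurableT_comp (@measurable_first_coords R m.+1 n.+1)).
  exact: measurable_sphere_val.
have mZf : measurable [set y : sphere R n | Z (first_coords m.+1 y)].
  by rewrite -[X in measurable X]setTI; exact: mf.
have inZ x : (x \in Z) = (enorm x == 0%R) by apply/idP/eqP; rewrite inE.
transitivity (\int[sphere_unif R n]_y (\1_Z (first_coords m.+1 y))%:E).
  rewrite -[LHS]mul1e -integral_cst // integral_mkcond.
  apply: eq_integral => y _; rewrite patchE indicE inZ.
  case: eqP => [y0|y0]; first by rewrite ifT // inE.
  by rewrite ifF //; apply: negbTE; rewrite notin_setE.
rewrite ge0_sphere_unif_first_coords //.
  by apply: integral0_eq => y _; rewrite indicE inZ enorm_sphere oner_eq0.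
move=> r x r0; rewrite !indicE !inZ enorm_tscale ?ltW //.
by rewrite mulf_eq0 (gt_eqF r0).
Qed.

(** The polar decomposition in degrees 0 and 1, on both spheres, gives four
equations between Gaussian integrals and Gamma values; eliminating the ball
volumes and the Gaussian integrals leaves the quotient. *)
Lemma sphere_unif_enorm_first_coords :
  (\int[sphere_unif R n]_y enorm (first_coords m.+1 y) =
  Gamma ((m + 2)%:R / 2) * Gamma ((n + 1)%:R / 2) /
  (Gamma ((m + 1)%:R / 2) * Gamma ((n + 2)%:R / 2)))%R.
Proof.
rewrite !addn1 !addn2.
have [I [I0 gI HI]] := gauss_factor.
have hE k r (x : k.-tuple R) :
    (0 < r)%R -> enorm (tscale r x) = (r `^ 1 * enorm x)%R.
  by move=> r0; rewrite powRr1 ?enorm_tscale ?ltW.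
have mfc : measurable_fun setT (fun x => enorm (@first_coords R m.+1 n.+1 x)).
  apply: (measurableT_comp (@measurable_enorm R m.+1)).
  exact: measurable_first_coords.
have [vol [vol0 VE]] : exists vol : nat -> R, (forall k, (0 < vol k)%R) /\
    forall k, ball_volume k.+1 = (vol k)%:E.
  exists (fun k => fine (@ball_volume R k.+1)); split=> k;
    have [_ V0] := @eGamma_ball_volume_gt0_lty R k; first exact: fine_gt0.
  by case/andP: V0 => ? ?; rewrite fineK // ge0_fin_numE // ltW.
have := sphere_gaussian_homogeneous mfc (fun=> enorm_ge0 _)
  (first_coords_homogeneous (hE m.+1)).
have := sphere_gaussian_homogeneous (@measurable_enorm R m.+1) (@enorm_ge0 R _)
  (hE m.+1).
rewrite (HI _ (@measurable_enorm R m.+1) (@enorm_ge0 R m.+1)).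
have -> : \int[sphere_unif R m]_y (enorm y)%:E = 1.
  under eq_integral do rewrite enorm_sphere.
  by rewrite (integral_cst _ measurableT 1) mul1e; exact: probability_setT.
rewrite EFin_Rintegral; last exact: bounded_enorm_first_coords.
set C := (Rintegral _ _ _).
have := eGamma_ball_volume (R := R) n; have := eGamma_ball_volume (R := R) m.
rewrite 2!natr1 4!eGammaE 2!gaussE gI 2!radial_massE 2!VE mule1 -!EFinM.
set J := \int[_]_x _ => -[Em] [En] EJ EC.
have {}EJ : J = (Gamma (m.+2%:R / 2) * vol m * (m.+1%:R / 2))%:E.
  apply: (@pmule_inj R (2 / m.+1%:R)%:E).
    by rewrite lte_fin divr_gt0 ?ltry.
  have : (m.+1%:R != 0 :> R)%R by rewrite pnatr_eq0.
  rewrite -EJ -EFinM; move: (m.+1%:R)%R => M M0; congr EFin; field.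
  exact: M0.
move: EC; rewrite EJ -!EFinM => -[].
have := gauss_gt0 m.+1.
have := vol0 m; have := vol0 n.
have := Gamma_gt0 m; have := Gamma_gt0 n; have := Gamma_gt0 n.+1.
have : (n.+1%:R != 0 :> R)%R by rewrite pnatr_eq0.
have : (m.+1%:R != 0 :> R)%R by rewrite pnatr_eq0.
move: Em En.
move: (Gamma (m.+1%:R / 2)) (Gamma (m.+2%:R / 2)) (Gamma (n.+1%:R / 2))
  (Gamma (n.+2%:R / 2)) (gauss _) (vol m) (vol n) => a a' b b' g v w.
move: (m.+1%:R)%R (n.+1%:R)%R => M N av bw M0 N0 b'0 b0 a0 w0 v0 g0 EC.
have nz : (a * b' * w != 0)%R by rewrite !mulf_neq0 // gt_eqF.
apply: (mulfI nz).
have -> : (a * b' * w * C = a * (b' * (w * C)))%R by rewrite !mulrA.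
rewrite EC.
have -> : (a * (2 / N * (a' * v * (M / 2) * I)) =
           2 / N * a' * M / 2 * I * (a * v))%R by ring.
rewrite av.
have -> : (2 / N * a' * M / 2 * I * (2 / M * g) = a' * (2 / N * (g * I)))%R.
  by field; rewrite M0 N0.
by rewrite -bw; field; rewrite !gt_eqF.
Qed.

End mean.
End equatorial_mean.

(** * Moments of the uniform measure *)

Section moments.
Context {R : realType}.

Definition flip_mx k (j : 'I_k) : 'M[R]_k :=
  diag_mx (\row_l (if l == j then -1 else 1)).

Lemma orthogonal_flip_mx k (j : 'I_k) : orthogonal_mx (flip_mx j).
Proof.
rewrite /orthogonal_mx /flip_mx tr_diag_mx mulmx_diag -diag_const_mx.
congr diag_mx; apply/rowP => l; rewrite !mxE.
by case: ifP => _; rewrite ?mulrNN mulr1.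
Qed.

Lemma tnth_flip_mx k (j l : 'I_k) (x : k.-tuple R) :
  tnth (mxact (flip_mx j) x) l = (if l == j then - tnth x l else tnth x l).
Proof.
rewrite tnth_mktuple mul_diag_mx !mxE.
by case: ifP => _; rewrite ?mulN1r ?mul1r.
Qed.

Lemma orthogonal_perm_mx k (s : {perm 'I_k}) :
  orthogonal_mx (perm_mx s : 'M[R]_k).
Proof. by rewrite /orthogonal_mx tr_perm_mx -perm_mxM mulVg perm_mx1. Qed.

Lemma tnth_perm_mx k (s : {perm 'I_k}) l (x : k.-tuple R) :
  tnth (mxact (perm_mx s) x) l = tnth x (s l).
Proof. by rewrite tnth_mktuple -row_permE !mxE. Qed.

Lemma radial_sphere n (y : sphere R n) : radial y = y.
Proof.
apply: val_inj; rewrite /= radialE ?normalizeE enorm_sphere ?oner_eq0 //.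
by rewrite invr1; apply: vec_inj; rewrite vec_tscale scale1r.
Qed.

Lemma Rintegral_sphere_unif_mxact n (P : 'M[R]_n.+1) (g : n.+1.-tuple R -> R) :
  orthogonal_mx P -> measurable_fun setT g ->
  \int[sphere_unif R n]_y g (mxact P y) = \int[sphere_unif R n]_y g y.
Proof.
move=> oP mg.
pose T (y : sphere R n) : sphere R n := radial (mxact P y).
have TE y : sphere_val (T y) = mxact P y.
  rewrite radialE ?normalizeE enorm_mxact // enorm_sphere ?oner_eq0 //.
  by rewrite invr1; apply: vec_inj; rewrite vec_tscale scale1r.
have mT : measurable_fun setT T.
  apply: (measurableT_comp (@measurable_radial R n)).
  apply: (measurableT_comp (measurable_mxact P)).
  exact: measurable_sphere_val.
transitivity (\int[sphere_unif R n]_y (g \o @sphere_val R n) (T y)).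
  by apply: eq_Rintegral => y _ /=; rewrite TE.
apply: Rintegral_transfer; last first.
  exact: (measurableT_comp mg (@measurable_sphere_val R n)).
move=> h mh h0.
have mhr : measurable_fun setT (h \o @radial R n).
  by apply: (measurableT_comp mh); exact: measurable_radial.
rewrite /T (ge0_sphere_unif_mxact oP mhr (fun=> h0 _)) /=.
by apply: eq_integral => y _; rewrite radial_sphere.
Qed.

Section equatorial_moments.
Variables (m n : nat) (hmn : (m <= n)%N).

Definition widen_coord (i : 'I_m.+1) : 'I_n.+1 :=
  widen_ord (hmn : (m.+1 <= n.+1)%N) i.

Lemma tnth_first_coords (x : n.+1.-tuple R) i :
  tnth (first_coords m.+1 x) i = tnth x (widen_coord i).
Proof. by rewrite tnth_mktuple (tnth_nth 0). Qed.

Definition equator (x : n.+1.-tuple R) : m.+1.-tuple R :=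
  normalize (first_coords m.+1 x).

Lemma measurable_equator : measurable_fun setT equator.
Proof.
apply: (measurableT_comp (@measurable_normalize R m.+1)).
exact: measurable_first_coords.
Qed.

Lemma tnth_normalize k (x : k.-tuple R) i :
  tnth (normalize x) i = tnth x i / enorm x.
Proof. by rewrite tnth_mktuple. Qed.

(** This also holds where the first coordinates vanish, as both sides are then
zero; so no point of the sphere has to be excluded. *)
Lemma enorm_first_coords_equator x i :
  enorm (first_coords m.+1 x) * tnth (equator x) i = tnth x (widen_coord i).
Proof.
rewrite tnth_normalize tnth_first_coords mulrCA.
have [z0|z0] := eqVneq (enorm (first_coords m.+1 x)) 0.
  rewrite z0 mul0r mulr0 -tnth_first_coords; apply/esym.
  by move/eqP/enorm_eq0P: z0; apply.
by rewrite divff // mulr1.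
Qed.

Lemma bounded_coord (j : 'I_n.+1) :
  bounded_measurable (fun y : sphere R n => tnth y j).
Proof.
split.
  apply: (measurableT_comp (measurable_tnth j)).
  exact: measurable_sphere_val.
by exists 1 => y; rewrite -(enorm_sphere y) ler_tnth_enorm.
Qed.

Lemma bounded_equator (i : 'I_m.+1) :
  bounded_measurable (fun y : sphere R n => tnth (equator y) i).
Proof.
split.
  apply: (measurableT_comp (measurable_tnth i)).
  by apply: (measurableT_comp measurable_equator); exact: measurable_sphere_val.
exists 1 => y; rewrite tnth_normalize normrM normfV (ger0_norm (enorm_ge0 _)).
set z := first_coords _ _; have [z0|z0] := eqVneq (enorm z) 0.
  by rewrite z0 invr0 mulr0.
by rewrite ler_pdivrMr ?mul1r ?ler_tnth_enorm // lt_neqAle eq_sym z0 enorm_ge0.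
Qed.

Lemma equator_flip (j : 'I_n.+1) x i : widen_coord i != j ->
  tnth (equator (mxact (flip_mx j) x)) i = tnth (equator x) i.
Proof.
move=> ij; rewrite !tnth_normalize !tnth_first_coords tnth_flip_mx (negPf ij).
congr (_ / _); apply: eq_enorm; rewrite !sqr_enorm; apply: eq_bigr => l _.
by rewrite !tnth_first_coords tnth_flip_mx; case: ifP; rewrite ?sqrrN.
Qed.

Lemma equator_perm (i i' : 'I_m.+1) x :
  let s := tperm (widen_coord i) (widen_coord i') in
  tnth (equator (mxact (perm_mx s) x)) i = tnth (equator x) i'.
Proof.
move=> s; have winj : injective widen_coord by move=> a b [] /val_inj.
have -> : equator (mxact (perm_mx s) x) =
    mxact (perm_mx (tperm i i')) (equator x).
  apply: eq_from_tnth => l; rewrite tnth_perm_mx !tnth_normalize.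
  have fE : first_coords m.+1 (mxact (perm_mx s) x) =
      mxact (perm_mx (tperm i i')) (first_coords m.+1 x).
    apply: eq_from_tnth => r.
    by rewrite tnth_perm_mx !tnth_first_coords tnth_perm_mx inj_tperm.
  by rewrite fE enorm_mxact ?tnth_perm_mx //; exact: orthogonal_perm_mx.
by rewrite tnth_perm_mx tpermL.
Qed.

Definition mean_equator : R :=
  \int[sphere_unif R n]_y enorm (first_coords m.+1 y).

(** Flipping the sign of coordinate j changes the sign of the integrand unless
j is i.  The diagonal moments agree by swapping two of the first coordinates,
and their sum is the mean norm of these coordinates. *)
Lemma equatorial_moment i j :
  \int[sphere_unif R n]_y (tnth (equator y) i * tnth y j) =
  if widen_coord i == j then mean_equator / m.+1%:R else 0.
Proof.
have mg i' j' : measurable_fun setT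
    (fun x : n.+1.-tuple R => tnth (equator x) i' * tnth x j').
  apply: measurable_funM; last exact: measurable_tnth.
  by apply: (measurableT_comp (measurable_tnth i')); exact: measurable_equator.
have bg i' j' := bounded_measurableM (bounded_equator i') (bounded_coord j').
case: eqVneq => [<-|ij].
  pose D i' := \int[sphere_unif R n]_y
    (tnth (equator y) i' * tnth y (widen_coord i')).
  have DE i' : D i' = D i.
    rewrite /D -[RHS](Rintegral_sphere_unif_mxact
      (orthogonal_perm_mx (tperm (widen_coord i) (widen_coord i'))) (mg _ _)).
    by apply: eq_Rintegral => y _; rewrite equator_perm tnth_perm_mx tpermL.
  have : \sum_i' D i' = mean_equator.
    rewrite /D -bounded_Rintegral_sum //.
    apply: eq_Rintegral => y _.
    under eq_bigr do rewrite -enorm_first_coords_equator mulrCA -expr2.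
    rewrite -mulr_sumr -sqr_enorm.
    set z := first_coords _ _; have [z0|z0] := eqVneq (enorm z) 0.
      by rewrite z0 mul0r.
    by rewrite enorm_normalize // expr1n mulr1.
  rewrite (eq_bigr (fun=> D i)) // sumr_const card_ord => <-.
  by rewrite -(mulr_natr (D i)) mulfK // pnatr_eq0.
set v := LHS; suff : v = - v.
  by move/eqP; rewrite -addr_eq0 -mulr2n mulrn_eq0 => /eqP.
rewrite {1}/v -(Rintegral_sphere_unif_mxact (orthogonal_flip_mx j) (mg _ _)).
rewrite -mulN1r /v -bounded_RintegralZl //.
apply: eq_Rintegral => y _; rewrite equator_flip // tnth_flip_mx eqxx.
by rewrite mulrN mulN1r.
Qed.

End equatorial_moments.

(** The case m = n of the previous moments, where the projection is the
identity. *)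
Lemma sphere_second_moment n (i j : 'I_n.+1) :
  \int[sphere_unif R n]_y (tnth y i * tnth y j) =
  if i == j then n.+1%:R^-1 else 0.
Proof.
have fE (y : sphere R n) : first_coords n.+1 y = y.
  by apply: eq_from_tnth => l; rewrite tnth_mktuple -tnth_nth.
have := equatorial_moment (leqnn n) i j.
have -> : widen_coord (leqnn n) i = i by exact: val_inj.
have -> : mean_equator n n = 1.
  rewrite /mean_equator; under eq_Rintegral do rewrite fE enorm_sphere.
  rewrite Rintegral_cst // mul1r.
  exact: (congr1 fine (probability_setT (sphere_unif R n))).
rewrite mul1r => <-; apply: eq_Rintegral => y _.
by rewrite /equator fE tnth_normalize enorm_sphere divr1.
Qed.

End moments.

(** * The distortion and the correlation matrix *)

Section distortion.
Context {R : realType} {m n : nat}.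
Local Notation X := (sphere R m).
Local Notation Y := (sphere R n).
Implicit Type g : probability (X * Y)%type R.

Lemma bounded_linear_comb d (T : measurableType d) p q (a : 'I_p -> 'I_q -> R)
    (h : 'I_p -> 'I_q -> T -> R) : (forall i j, bounded_measurable (h i j)) ->
  bounded_measurable (fun x => \sum_i \sum_j a i j * h i j x).
Proof.
move=> hb.
apply: bounded_measurable_sum => i; apply: bounded_measurable_sum => j.
by apply: bounded_measurableM => //; exact: bounded_measurable_cst.
Qed.

Lemma Rintegral_linear_comb d (T : measurableType d) (P : probability T R) p q
    (a : 'I_p -> 'I_q -> R) (h : 'I_p -> 'I_q -> T -> R) :
  (forall i j, bounded_measurable (h i j)) ->
  \int[P]_x (\sum_i \sum_j a i j * h i j x) =
  \sum_i \sum_j a i j * \int[P]_x h i j x.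
Proof.
move=> hb.
have hbz i j : bounded_measurable (fun x => a i j * h i j x).
  by apply: bounded_measurableM => //; exact: bounded_measurable_cst.
rewrite bounded_Rintegral_sum => [|i]; last exact: bounded_measurable_sum.
apply: eq_bigr => i _; rewrite bounded_Rintegral_sum //.
by apply: eq_bigr => j _; rewrite bounded_RintegralZl.
Qed.

Lemma dist_sphereE k (x y : sphere R k) :
  sphere_dist x y ^+ 2 = 2 - 2 * \sum_i tnth x i * tnth y i.
Proof.
rewrite /sphere_dist /edist sqr_enorm.
under eq_bigr do rewrite tnth_mktuple sqrrB.
rewrite big_split /= sumrB /= -!sqr_enorm !enorm_sphere sumrMnl -mulr_natl.
by ring.
Qed.

Definition corr g : 'M[R]_(m.+1, n.+1) :=
  \matrix_(i, j) \int[g]_p (tnth p.1 i * tnth p.2 j).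

Definition distortion4 (f : R) : R := 4 * (m.+1%:R^-1 + n.+1%:R^-1 - 2 * f).

Lemma bounded_coord1 i :
  bounded_measurable (fun p : (X * Y)%type => tnth p.1 i).
Proof. exact: (bounded_measurable_comp (phi := fst) _ (bounded_coord i)). Qed.

Lemma bounded_coord2 j :
  bounded_measurable (fun p : (X * Y)%type => tnth p.2 j).
Proof. exact: (bounded_measurable_comp (phi := snd) _ (bounded_coord j)). Qed.

Lemma coupling_fst g (f : X -> R) :
  coupling (sphere_unif R m) (sphere_unif R n) g -> measurable_fun setT f ->
  \int[g]_p f p.1 = \int[sphere_unif R m]_x f x.
Proof.
move=> [g1 _] mf; apply: Rintegral_transfer => // h mh h0.
apply: ge0_integral_marginal => // A mA.
by rewrite -g1 //; congr (g _); apply/seteqP; split => [[x y]|[x y] []].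
Qed.

Lemma coupling_snd g (f : Y -> R) :
  coupling (sphere_unif R m) (sphere_unif R n) g -> measurable_fun setT f ->
  \int[g]_p f p.2 = \int[sphere_unif R n]_y f y.
Proof.
move=> [_ g2] mf; apply: Rintegral_transfer => // h mh h0.
apply: ge0_integral_marginal => // A mA.
by rewrite -g2 //; congr (g _); apply/seteqP; split => [[x y]|[x y] []].
Qed.

Lemma sum_second_moment k (x : sphere R k) :
  \sum_i \sum_j tnth x i * tnth x j *
    \int[sphere_unif R k]_y (tnth y i * tnth y j) = k.+1%:R^-1.
Proof.
transitivity (\sum_i tnth x i ^+ 2 * k.+1%:R^-1).
  apply: eq_bigr => i _; rewrite (bigD1 i) //= sphere_second_moment eqxx -expr2.
  rewrite big1 ?addr0 // => j ji.
  by rewrite sphere_second_moment eq_sym (negPf ji) mulr0.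
by rewrite -mulr_suml -sqr_enorm enorm_sphere expr1n mul1r.
Qed.

Lemma sum_sum_mul p q (a : 'I_p -> R) (b : 'I_q -> R) :
  (\sum_i a i) * (\sum_j b j) = \sum_i \sum_j a i * b j.
Proof.
by rewrite mulr_suml; apply: eq_bigr => i _; rewrite mulr_sumr.
Qed.

(** The pure terms of the expanded square are evaluated by the marginals; the
mixed term keeps the correlation matrix. *)
Lemma distortion_inner g (p : (X * Y)%type) :
  coupling (sphere_unif R m) (sphere_unif R n) g ->
  (\int[g]_q (`|sphere_dist p.1 q.1 ^+ 2 - sphere_dist p.2 q.2 ^+ 2| ^+ 2)%:E =
   (4 * (m.+1%:R^-1 + n.+1%:R^-1) +
    -8 * \sum_i \sum_j corr g i j * (tnth p.1 i * tnth p.2 j))%:E)%E.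
Proof.
move=> cg.
pose hA i j (q : (X * Y)%type) := tnth q.1 i * tnth q.1 j.
pose hB i j (q : (X * Y)%type) := tnth q.2 i * tnth q.2 j.
pose hM i j (q : (X * Y)%type) := tnth q.1 i * tnth q.2 j.
have bA i j : bounded_measurable (hA i j).
  by apply: bounded_measurableM; exact: bounded_coord1.
have bB i j : bounded_measurable (hB i j).
  by apply: bounded_measurableM; exact: bounded_coord2.
have bM i j : bounded_measurable (hM i j).
  by apply: bounded_measurableM; [exact: bounded_coord1|exact: bounded_coord2].
pose SA q := \sum_i \sum_j (tnth p.1 i * tnth p.1 j) * hA i j q.
pose SB q := \sum_i \sum_j (tnth p.2 i * tnth p.2 j) * hB i j q.
pose SM q := \sum_i \sum_j (tnth p.1 i * tnth p.2 j) * hM i j q.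
have bSA : bounded_measurable SA by exact: bounded_linear_comb.
have bSB : bounded_measurable SB by exact: bounded_linear_comb.
have bSM : bounded_measurable SM by exact: bounded_linear_comb.
have bZ r f : bounded_measurable f ->
    bounded_measurable (fun q : (X * Y)%type => r * f q : R).
  by move=> bf; apply: bounded_measurableM => //; exact: bounded_measurable_cst.
transitivity (\int[g]_q (4 * SA q + (4 * SB q + -8 * SM q))%:E)%E.
  apply: eq_integral => q _; congr EFin.
  rewrite real_normK ?num_real // !dist_sphereE.
  set u := \sum_i _; set v := \sum_i _.
  have -> : SA q = u * u.
    rewrite sum_sum_mul; apply: eq_bigr => i _; apply: eq_bigr => j _.
    by rewrite /hA mulrACA.
  have -> : SB q = v * v.
    rewrite sum_sum_mul; apply: eq_bigr => i _; apply: eq_bigr => j _.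
    by rewrite /hB mulrACA.
  have -> : SM q = u * v.
    rewrite sum_sum_mul; apply: eq_bigr => i _; apply: eq_bigr => j _.
    by rewrite /hM mulrACA.
  by ring.
have bBM := bounded_measurableD (bZ 4 _ bSB) (bZ (-8) _ bSM).
have bAll := bounded_measurableD (bZ 4 _ bSA) bBM.
rewrite (EFin_Rintegral _ bAll) (bounded_RintegralD _ (bZ 4 _ bSA) bBM).
rewrite (bounded_RintegralD _ (bZ 4 _ bSB) (bZ (-8) _ bSM)).
rewrite !bounded_RintegralZl // !Rintegral_linear_comb //.
have -> : \sum_i \sum_j tnth p.1 i * tnth p.1 j * \int[g]_x hA i j x =
    m.+1%:R^-1.
  rewrite -(sum_second_moment p.1).
  apply: eq_bigr => i _; apply: eq_bigr => j _.
  have mf := (bounded_measurableM (bounded_coord (R := R) i)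
                                  (bounded_coord (R := R) j)).1.
  by congr (_ * _); exact: (coupling_fst cg mf).
have -> : \sum_i \sum_j tnth p.2 i * tnth p.2 j * \int[g]_x hB i j x =
    n.+1%:R^-1.
  rewrite -(sum_second_moment p.2).
  apply: eq_bigr => i _; apply: eq_bigr => j _.
  have mf := (bounded_measurableM (bounded_coord (R := R) i)
                                  (bounded_coord (R := R) j)).1.
  by congr (_ * _); exact: (coupling_snd cg mf).
rewrite addrA -mulrDr; congr (_ + _ * _)%:E.
by apply: eq_bigr => i _; apply: eq_bigr => j _; rewrite mxE mulrC.
Qed.

Lemma distortionE g : coupling (sphere_unif R m) (sphere_unif R n) g ->
  (\int[g]_p \int[g]_q
     (`|sphere_dist p.1 q.1 ^+ 2 - sphere_dist p.2 q.2 ^+ 2| ^+ 2)%:E =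
   (distortion4 (sqr_frob (corr g)))%:E)%E.
Proof.
move=> cg; under eq_integral do rewrite distortion_inner //.
have bM i j : bounded_measurable
    (fun q : (X * Y)%type => tnth q.1 i * tnth q.2 j).
  by apply: bounded_measurableM; [exact: bounded_coord1|exact: bounded_coord2].
have bS : bounded_measurable
    (fun p : (X * Y)%type =>
      \sum_i \sum_j corr g i j * (tnth p.1 i * tnth p.2 j)).
  exact: bounded_linear_comb.
have bS8 := bounded_measurableM (bounded_measurable_cst (-8)) bS.
have bC := bounded_measurable_cst (T := (X * Y)%type)
  (4 * (m.+1%:R^-1 + n.+1%:R^-1) : R).
rewrite (EFin_Rintegral _ (bounded_measurableD bC bS8)).
rewrite (bounded_RintegralD _ bC bS8).
rewrite Rintegral_cst // bounded_RintegralZl // Rintegral_linear_comb //.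
rewrite [fine _](congr1 fine (probability_setT g)) mulr1 /distortion4.
have -> : \sum_i \sum_j corr g i j * \int[g]_x (tnth x.1 i * tnth x.2 j) =
    sqr_frob (corr g).
  by apply: eq_bigr => i _; apply: eq_bigr => j _; rewrite expr2 {3}/corr mxE.
by congr EFin; ring.
Qed.

Lemma dis42E g : coupling (sphere_unif R m) (sphere_unif R n) g ->
  dis42 (@sphere_dist R m) (@sphere_dist R n) g =
  (distortion4 (sqr_frob (corr g)) `^ 4^-1)%:E.
Proof. by move=> cg; rewrite /dis42 distortionE. Qed.

Lemma distortion4_ge0 g : coupling (sphere_unif R m) (sphere_unif R n) g ->
  0 <= distortion4 (sqr_frob (corr g)).
Proof.
move=> cg; rewrite -lee_fin -distortionE //.
apply: integral_ge0 => p _; apply: integral_ge0 => q _.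
by rewrite lee_fin exprn_ge0.
Qed.

End distortion.

(** * The bound on the correlation matrix and its equality case *)

Section equatorial_optimal.
Context {R : realType} {m n : nat}.
Variable hmn : (m <= n)%N.
Local Notation X := (sphere R m).
Local Notation Y := (sphere R n).
Local Notation C := (mean_equator (R := R) m n).

Lemma sum_widen_coord (G : 'I_n.+1 -> R) :
  (forall j : 'I_n.+1, (m.+1 <= j)%N -> G j = 0) ->
  \sum_j G j = \sum_l G (widen_coord hmn l).
Proof.
move=> G0; rewrite (bigID (fun j : 'I_n.+1 => (j < m.+1)%N)) /= addrC big1 ?add0r.
  by rewrite (big_ord_narrow (hmn : (m.+1 <= n.+1)%N)).
by move=> j; rewrite -leqNgt => /G0.
Qed.

(** This is |q_A| (s + |B u|^2 / s) / 2, where B is the block of the first m+1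
columns of N and u = q_A / |q_A|: the factor |q_A| is absorbed in one of the two
copies of u, so that the mean is a combination of equatorial moments. *)
Definition majorant (N : 'M[R]_(m.+1, n.+1)) (s : R) (q : n.+1.-tuple R) : R :=
  2^-1 * (s * enorm (first_coords m.+1 q) + s^-1 * \sum_l \sum_j
    (\sum_i N i (widen_coord hmn l) * N i j) * (tnth (equator m q) l * tnth q j)).

(** Coordinatewise, the difference of the two sides is
|q_A| (s x_i - (B u)_i)^2 / (2 s). *)
Lemma le_majorant (N : 'M[R]_(m.+1, n.+1)) s (x : X) (q : n.+1.-tuple R) :
  0 < s -> (forall i (j : 'I_n.+1), (m.+1 <= j)%N -> N i j = 0) ->
  \sum_i tnth x i * \sum_j N i j * tnth q j <= majorant N s q.
Proof.
move=> s0 N0.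
set w := enorm (first_coords m.+1 q).
pose z i := \sum_j N i j * tnth q j.
pose v i := \sum_l N i (widen_coord hmn l) * tnth (equator m q) l.
have zv i : z i = w * v i.
  rewrite /z sum_widen_coord => [|j mj]; last by rewrite N0 // mul0r.
  rewrite /v mulr_sumr; apply: eq_bigr => l _.
  by rewrite -enorm_first_coords_equator mulrCA.
have -> : majorant N s q =
    \sum_i 2^-1 * (s * w * tnth x i ^+ 2 + s^-1 * (z i * v i)).
  rewrite -mulr_sumr big_split /= -!mulr_sumr -sqr_enorm enorm_sphere expr1n mulr1.
  congr (_ * (_ + _ * _)).
  transitivity (\sum_i \sum_l \sum_j
      N i (widen_coord hmn l) * N i j * (tnth (equator m q) l * tnth q j)).
    rewrite [RHS]exchange_big /=; apply: eq_bigr => l _.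
    rewrite [RHS]exchange_big /=.
    by apply: eq_bigr => j _; rewrite mulr_suml.
  apply: eq_bigr => i _; rewrite mulrC sum_sum_mul.
  by apply: eq_bigr => l _; apply: eq_bigr => j _; rewrite mulrACA.
apply: ler_sum => i _; rewrite -/(z i) zv.
have w0 : 0 <= w by exact: enorm_ge0.
rewrite -subr_ge0.
have -> : 2^-1 * (s * w * tnth x i ^+ 2 + s^-1 * (w * v i * v i)) -
    tnth x i * (w * v i) = 2^-1 * (w * s^-1) * (s * tnth x i - v i) ^+ 2.
  by field; rewrite gt_eqF.
apply: mulr_ge0; last exact: sqr_ge0.
by rewrite mulr_ge0 ?invr_ge0 // mulr_ge0 // invr_ge0 ltW.
Qed.

Lemma bounded_majorant_sum (a : 'I_m.+1 -> 'I_n.+1 -> R) :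
  bounded_measurable (fun y : Y =>
    \sum_l \sum_j a l j * (tnth (equator m y) l * tnth y j)).
Proof.
apply: bounded_linear_comb => l j.
by apply: bounded_measurableM; [exact: bounded_equator|exact: bounded_coord].
Qed.

Lemma bounded_majorant N s : bounded_measurable (fun y : Y => majorant N s y).
Proof.
apply: bounded_measurableM; first exact: bounded_measurable_cst.
apply: bounded_measurableD; apply: bounded_measurableM;
  try exact: bounded_measurable_cst.
  exact: bounded_enorm_first_coords.
exact: bounded_majorant_sum.
Qed.

Lemma measurable_majorant N s : measurable_fun setT (majorant N s).
Proof.
apply: measurable_funM => //; apply: measurable_funD; apply: measurable_funM => //.
  apply: (measurableT_comp (@measurable_enorm R m.+1)).
  exact: measurable_first_coords.
apply: measurable_sum => l; apply: measurable_sum => j.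
apply: measurable_funM => //; apply: measurable_funM; last exact: measurable_tnth.
by apply: (measurableT_comp (measurable_tnth l)); exact: measurable_equator.
Qed.

Lemma Rintegral_majorant (N : 'M[R]_(m.+1, n.+1)) s :
  (forall i (j : 'I_n.+1), (m.+1 <= j)%N -> N i j = 0) ->
  \int[sphere_unif R n]_y majorant N s y =
  2^-1 * (s * C + s^-1 * (sqr_frob N * (C / m.+1%:R))).
Proof.
move=> N0.
have bE := bounded_enorm_first_coords (R := R) hmn.
have bS := bounded_majorant_sum
  (fun l j => \sum_i N i (widen_coord hmn l) * N i j).
have bsE := bounded_measurableM (bounded_measurable_cst s) bE.
have bsS := bounded_measurableM (bounded_measurable_cst s^-1) bS.
rewrite /majorant (bounded_RintegralZl _ _ (bounded_measurableD bsE bsS)).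
rewrite (bounded_RintegralD _ bsE bsS) !bounded_RintegralZl //.
congr (_ * (_ + _ * _)).
rewrite Rintegral_linear_comb => [|l j]; last first.
  by apply: bounded_measurableM; [exact: bounded_equator|exact: bounded_coord].
transitivity (\sum_l (\sum_i N i (widen_coord hmn l) ^+ 2) * (C / m.+1%:R)).
  apply: eq_bigr => l _; rewrite (bigD1 (widen_coord hmn l)) //=.
  rewrite (equatorial_moment hmn) eqxx [X in _ + X]big1 ?addr0 => [|j jl].
    by congr (_ * _); apply: eq_bigr => i _; rewrite expr2.
  by rewrite (equatorial_moment hmn) eq_sym (negPf jl) mulr0.
rewrite -mulr_suml exchange_big /=; congr (_ * _); apply: eq_bigr => i _.
by rewrite sum_widen_coord // => j mj; rewrite N0 // expr0n.
Qed.

(** The squared norm of M is the mean of <x, M y>, below the mean of the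
majorant for M P at P^T y; by invariance the mean is the same at y. *)
Lemma sqr_frob_corr_le (g : probability (X * Y)%type R) :
  coupling (sphere_unif R m) (sphere_unif R n) g ->
  sqr_frob (corr g) <= C ^+ 2 / m.+1%:R.
Proof.
move=> cg; set M := corr g; set f := sqr_frob M.
have f0 : 0 <= f by exact: sqr_frob_ge0.
have M0 : 0 < m.+1%:R :> R by rewrite ltr0n.
have [fz|fnz] := eqVneq f 0; first by rewrite fz divr_ge0 ?sqr_ge0 // ltW.
have fgt0 : 0 < f by rewrite lt_neqAle eq_sym fnz.
have [P oP N0] := lower_trapezoidal M; set N := M *m P in N0.
have fN : sqr_frob N = f by rewrite sqr_frob_orthogonal.
(* The minimizer in s of the mean of the majorant. *)
pose s := Num.sqrt (f / m.+1%:R).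
have s0 : 0 < s by rewrite sqrtr_gt0 divr_gt0.
have s2 : s ^+ 2 = f / m.+1%:R by rewrite sqr_sqrtr // divr_ge0 // ltW.
have oPT : orthogonal_mx P^T by rewrite /orthogonal_mx trmxK orthogonal_mxC.
have bM (i : 'I_m.+1) (j : 'I_n.+1) :
    bounded_measurable (fun p : (X * Y)%type => tnth p.1 i * tnth p.2 j).
  by apply: bounded_measurableM; [exact: bounded_coord1|exact: bounded_coord2].
have mPT : measurable_fun setT (fun x => majorant N s (mxact P^T x)).
  exact: (measurableT_comp (measurable_majorant N s) (measurable_mxact _)).
have bPT : bounded_measurable (fun y : Y => majorant N s (mxact P^T y)).
  split; first exact: (measurableT_comp mPT (@measurable_sphere_val R n)).
  have [_ [B hB]] := bounded_majorant N s; exists B => y.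
  have z0 : enorm (mxact P^T y) != 0.
    by rewrite enorm_mxact // enorm_sphere oner_eq0.
  have := hB (radial (mxact P^T y)).
  rewrite radialE // normalizeE enorm_mxact // enorm_sphere invr1.
  congr (`|majorant N s _| <= _).
  by apply: vec_inj; rewrite vec_tscale scale1r.
have fsC : f <= s * C.
  have -> : s * C = \int[g]_p majorant N s (mxact P^T p.2).
    rewrite (coupling_snd (f := fun y => majorant N s (mxact P^T y)) cg bPT.1).
    rewrite (Rintegral_sphere_unif_mxact oPT (measurable_majorant N s)).
    have fC : f * (C / m.+1%:R) = s ^+ 2 * C by rewrite s2 mulrA mulrAC.
    by rewrite Rintegral_majorant // fN fC; field; rewrite gt_eqF.
  have -> : f = \int[g]_p \sum_i \sum_j M i j * (tnth p.1 i * tnth p.2 j).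
    rewrite Rintegral_linear_comb //.
    by apply: eq_bigr => i _; apply: eq_bigr => j _; rewrite expr2 {2}/M mxE.
  apply: bounded_le_Rintegral.
  - exact: bounded_linear_comb.
  - exact: (bounded_measurable_comp (phi := snd) _ bPT).
  move=> p; apply: le_trans (le_majorant p.1 _ s0 N0).
  have MN : M = N *m P^T by rewrite -mulmxA orthogonal_mxC // mulmx1.
  rewrite le_eqVlt; apply/orP; left; apply/eqP.
  apply: eq_bigr => i _; rewrite mulr_sumr.
  transitivity (tnth p.1 i * (M *m vec p.2) i 0).
    rewrite [(M *m _) _ _]mxE mulr_sumr; apply: eq_bigr => j _.
    by rewrite [vec _ _ _]mxE mulrCA.
  rewrite MN -mulmxA -vec_mxact [(N *m _) _ _]mxE mulr_sumr.
  by apply: eq_bigr => j _; rewrite [vec _ _ _]mxE.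
rewrite -(ler_pM2l fgt0) -expr2.
apply: le_trans (_ : (s * C) ^+ 2 <= _).
  by rewrite ler_sqr ?nnegrE // (le_trans f0 fsC).
by rewrite exprMn s2 -mulrA (mulrC m.+1%:R^-1).
Qed.

Section equatorial_coupling.
Variables (e : {mfun sphere R n >-> sphere R m}) (he : equatorial_map e).

Lemma equatorial_mapE (y : Y) : enorm (first_coords m.+1 y) != 0 ->
  e y = radial (first_coords m.+1 y).
Proof. by move=> y0; apply: val_inj; rewrite /= he // radialE. Qed.

Lemma ae_equatorial_map (Q : Y -> Prop) :
  (forall y : Y, enorm (first_coords m.+1 y) != 0 -> Q y) ->
  {ae sphere_unif R n, forall y, Q y}.
Proof.
move=> HQ; exists [set y : Y | enorm (first_coords m.+1 y) = 0]; split.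
- rewrite -[X in measurable X]setTI.
  have [mE _] := bounded_enorm_first_coords (R := R) hmn.
  by apply: (mE measurableT [set 0]); exact: measurable_set1.
- exact: sphere_unif_first_coords_neq0.
- by move=> y /= nQ; apply: contrapT => /eqP y0; apply: nQ; exact: HQ.
Qed.

(** The first marginal is the uniformity of the normalized first coordinates,
applied to indicator functions extended radially. *)
Lemma coupling_equatorial :
  coupling (sphere_unif R m) (sphere_unif R n) (equatorial_coupling e).
Proof.
split => [A mA|B mB]; last first.
  rewrite /equatorial_coupling /distribution /pushforward.
  by congr (sphere_unif R n _); apply/seteqP; split => [y []|y] //.
have mI : measurable_fun setT (\1_A : X -> R) by exact: measurable_indic.
have mIr : measurable_fun setT (\1_A \o @radial R m : _ -> R).
  by apply: (measurableT_comp mI); exact: measurable_radial.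
have mIe : measurable_fun setT (\1_A \o e : Y -> R).
  by apply: (measurableT_comp mI); exact: measurable_funP.
transitivity (\int[sphere_unif R n]_y (\1_A (e y))%:E)%E.
  transitivity (sphere_unif R n (e @^-1` A)).
    rewrite /equatorial_coupling /distribution /pushforward.
    by congr (sphere_unif R n _); apply/seteqP; split => [y []|y].
  have meA : measurable (e @^-1` A).
    by rewrite -[X in measurable X]setTI; exact: (measurable_funP e).
  rewrite -[LHS]mul1e -(integral_cst _ meA) integral_mkcond.
  apply: eq_integral => y _; rewrite patchE indicE.
  by have [eA|eA] := pselect (A (e y)); [rewrite !mem_set|rewrite !memNset].
transitivity (\int[sphere_unif R n]_y
    ((\1_A \o @radial R m) (first_coords m.+1 y))%:E)%E.
  apply: ae_eq_integral => //.
  - exact/measurable_EFinP.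
  - apply/measurable_EFinP; apply: (measurableT_comp mIr).
    apply: (measurableT_comp (@measurable_first_coords R m.+1 n.+1)).
    exact: measurable_sphere_val.
  - by apply: ae_equatorial_map => y y0 _ /=; rewrite equatorial_mapE.
rewrite ge0_sphere_unif_first_coords //; last 1 first.
- by move=> r x r0 /=; rewrite radial_tscale.
rewrite -[RHS]mul1e -integral_cst // [RHS]integral_mkcond.
by apply: eq_integral => y _; rewrite patchE /= radial_sphere indicE; case: ifPn.
Qed.

Lemma corr_equatorial i j :
  corr (equatorial_coupling e) i j =
  if widen_coord hmn i == j then C / m.+1%:R else 0.
Proof.
rewrite mxE -equatorial_moment.
have mij : measurable_fun setT
    (fun p : (X * Y)%type => tnth p.1 i * tnth p.2 j).
  exact: (bounded_measurableM (bounded_coord1 i) (bounded_coord2 j)).1.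
have mee : measurable_fun setT (fun y : Y => tnth (equator m y) i * tnth y j).
  exact: (bounded_measurableM (bounded_equator n i) (bounded_coord j)).1.
transitivity (\int[sphere_unif R n]_y (tnth (e y) i * tnth y j)).
  apply/esym.
  apply: (@Rintegral_transfer _ _ _ _ _ _ _ (graph_map e)
    (fun p : (X * Y)%type => tnth p.1 i * tnth p.2 j)) => // h mh h0.
  by rewrite [RHS]ge0_integral_distribution.
congr fine; apply: ae_eq_integral => //.
- apply/measurable_EFinP.
  exact: (measurableT_comp mij (measurable_graph_map e)).
- exact/measurable_EFinP.
- by apply: ae_equatorial_map => y y0 _ /=; rewrite equatorial_mapE // radialE.
Qed.

Lemma sqr_frob_corr_equatorial :
  sqr_frob (corr (equatorial_coupling e)) = C ^+ 2 / m.+1%:R.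
Proof.
transitivity (\sum_(i < m.+1) (C / m.+1%:R) ^+ 2).
  apply: eq_bigr => i _; rewrite (bigD1 (widen_coord hmn i)) //=.
  rewrite corr_equatorial eqxx big1 ?addr0 // => j ji.
  by rewrite corr_equatorial eq_sym (negPf ji) expr0n.
have : m.+1%:R != 0 :> R by rewrite pnatr_eq0.
rewrite sumr_const card_ord -(mulr_natl (_ ^+ 2)).
by move: (m.+1%:R) => M M0; field.
Qed.

End equatorial_coupling.
End equatorial_optimal.

(** * Optimality of the equatorial coupling *)

Lemma exists_equatorial_map (R : realType) (m n : nat) :
  exists e : {mfun sphere R n >-> sphere R m}, equatorial_map e.
Proof.
have mf : measurable_fun setT
    (fun y : sphere R n => @radial R m (first_coords m.+1 y)).
  apply: (measurableT_comp (@measurable_radial R m)).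
  apply: (measurableT_comp (@measurable_first_coords R m.+1 n.+1)).
  exact: measurable_sphere_val.
pose f_mixin := isMeasurableFun.Build _ _ _ _ _ mf.
pose f : {mfun sphere R n >-> sphere R m} :=
  HB.pack (fun y : sphere R n => @radial R m (first_coords m.+1 y)) f_mixin.
by exists f => y y0; rewrite /f /= radialE.
Qed.

(** The distortion decreases with the norm of the correlation matrix, which the
equatorial coupling maximizes. *)
Lemma equatorial_coupling_optimal (R : realType) (m n : nat) (hmn : (m <= n)%N)
    (e : {mfun sphere R n >-> sphere R m}) : equatorial_map e ->
  optimal42 (@sphere_dist R m) (@sphere_dist R n)
    (sphere_unif R m) (sphere_unif R n) (equatorial_coupling e).
Proof.
move=> he; have ce := coupling_equatorial hmn he; split => //.
apply/eqP; rewrite eq_le; apply/andP; split; last first.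
  by apply: ereal_inf_lbound; exists (equatorial_coupling e).
apply: le_ereal_inf_tmp => _ [g cg <-].
rewrite (dis42E ce) (dis42E cg) lee_fin.
apply: ge0_ler_powR; rewrite ?nnegrE ?distortion4_ge0 // ?invr_ge0 //.
rewrite /distortion4 ler_pM2l // lerD2l lerN2 ler_pM2l //.
by rewrite (sqr_frob_corr_equatorial hmn he) sqr_frob_corr_le.
Qed.

Theorem theorem1 (R : realType) (m n : nat) (hmn : (m <= n)%N) :
  (forall e : {mfun sphere R n >-> sphere R m}, equatorial_map e ->
     optimal42 (@sphere_dist R m) (@sphere_dist R n)
       (sphere_unif R m) (sphere_unif R n) (equatorial_coupling e) /\
     dGW42 (@sphere_dist R m) (@sphere_dist R n)
       (sphere_unif R m) (sphere_unif R n) =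
     ((2^-1)%:E * dis42 (@sphere_dist R m) (@sphere_dist R n)
       (equatorial_coupling e))%E) /\
  dGW42 (@sphere_dist R m) (@sphere_dist R n)
    (sphere_unif R m) (sphere_unif R n) =
  ((Num.sqrt 2)^-1 *
   ((m.+1%:R)^-1 + (n.+1%:R)^-1 -
    2 / m.+1%:R *
    (Gamma ((m + 2)%:R / 2) * Gamma ((n + 1)%:R / 2) /
     (Gamma ((m + 1)%:R / 2) * Gamma ((n + 2)%:R / 2))) ^+ 2) `^ (4^-1))%:E.
Proof.
have opt (e : {mfun sphere R n >-> sphere R m}) (he : equatorial_map e) :
    dGW42 (@sphere_dist R m) (@sphere_dist R n)
      (sphere_unif R m) (sphere_unif R n) =
    ((2^-1)%:E * dis42 (@sphere_dist R m) (@sphere_dist R n)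
      (equatorial_coupling e))%E.
  by have [_ inf] := equatorial_coupling_optimal hmn he; rewrite inf.
split => [e he|]; first by split; [exact: equatorial_coupling_optimal|exact: opt].
have [e he] := exists_equatorial_map R m n; have ce := coupling_equatorial hmn he.
rewrite (opt e he) dis42E // (sqr_frob_corr_equatorial hmn he).
rewrite /mean_equator sphere_unif_enorm_first_coords // -EFinM; congr EFin.
have := distortion4_ge0 ce.
rewrite (sqr_frob_corr_equatorial hmn he) /mean_equator.
rewrite sphere_unif_enorm_first_coords // /distortion4.
set c := _ / (_ * _).
have -> : 2 * (c ^+ 2 / m.+1%:R) = 2 / m.+1%:R * c ^+ 2 by rewrite mulrA mulrAC.
rewrite pmulr_rge0 //; set x := _ - _ => x0.
rewrite powRM // mulrA; congr (_ * _).
(* The factor 4 leaves the fourth root as sqrt 2. *)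
rewrite {1}(_ : 4 = 2 `^ 2 :> R); last by rewrite powR_mulrn // expr2; ring.
rewrite -powRrM (_ : 2 * 4^-1 = 2^-1 :> R); last by field.
have s0 : 0 < Num.sqrt 2 :> R by rewrite sqrtr_gt0.
rewrite powR12_sqrt // -{1}(sqr_sqrtr (ler0n R 2)).
by field; rewrite gt_eqF.
Qed.
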